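(* Let $M$ be a smooth manifold of dimension $n$ with a linear connection $\nabla$ having non-zero torsion $T$. Let $D\subset\mathfrak{X}(M)$ be an integrable distribution of constant dimension $p$ on $M$, and let $D'$ be a fixed, not necessarily integrable, distribution with $\mathfrak{X}(M)=D\oplus D'$. Let $A_X$ denote the shape map of $\nabla$ associated with a vector field $X$, let $\text{II}_D(X,Y):=(\nabla_XY)^\bot$ for $X,Y\in D$ be the second fundamental form on $D$, and let $\top$ and $\bot$ denote the projections onto $D$ and $D'$ respectively. Then for all $X,Y\in D$: 1. $\text{II}_D(X,Y)=A_X(Y)^\bot$; 2. $\text{II}_D$ is a bilinear form on $D$ (that is, it is linear over smooth functions in each of its two arguments); 3. $\text{II}_D(X,Y)-\text{II}_D(Y,X)=T(X,Y)^\bot$; 4. $(A_X(Y)-\nabla_XY)^\top=A_X(Y)-\nabla_XY$.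
   Context: $\mathfrak{X}(M)$ denotes the smooth vector fields on $M$. The torsion of $\nabla$ is $T(X,Y):=\nabla_XY-\nabla_YX-[X,Y]$. Shape map: for a vector field $Z$ on $M$ with (local) flow $\zeta_t$, let $\tau_t$ denote parallel transport with respect to $\nabla$ along the integral curve $t\mapsto\zeta_t(x)$ of $Z$, from $T_xM$ to $T_{\zeta_t(x)}M$. The shape map $A_Z$ is the endomorphism of each tangent space defined by $$A_Z(\xi):=\frac{d}{dt}\bigg\vert_{t=0}\tau_t^{-1}(\zeta_{t*}\xi),\qquad \xi\in T_xM.$$ For a vector field $Y$, $A_Z(Y)$ is the vector field obtained by applying $A_Z$ pointwise to $Y$. Distributions (sub-bundles of $TM$) are not distinguished from the submodules of $\mathfrak{X}(M)$ of vector fields they generate, so $X\in D$ means that $X$ is a vector field on $M$ with $X_x\in D_x$ for every $x$. Integrable means that $[X,Y]\in D$ whenever $X,Y\in D$. With $T_xM=D_x\oplus D'_x$ at every $x\in M$, $\pi^\top$ and $\pi^\bot$ are the corresponding projectors of $T_xM$ onto $D_x$ and $D'_x$ respectively, and $X^\top:=\pi^\top(X)$, $X^\bot:=\pi^\bot(X)$. The second fundamental form on $D$ takes values in $D'$. *)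

(* Defs.v *)
From HB Require Import structures.
From mathcomp Require Import all_boot all_order all_algebra.
From mathcomp Require Import all_classical all_reals all_analysis.

Set Implicit Arguments.
Unset Strict Implicit.
Unset Printing Implicit Defensive.

Import Order.TTheory GRing.Theory Num.Theory.
Import numFieldNormedType.Exports.

Local Open Scope classical_set_scope.
Local Open Scope ring_scope.

(* [U] is meant to be open.  Iterated directional derivatives along constant
   vectors; on finite-dimensional spaces, the only ones used below, this is the
   usual class C^k. *)
Fixpoint Ck_on (R : realType) (V W : normedModType R) (k : nat) (U : set V)
    (f : V -> W) : Prop :=
  (forall u, U u -> {for u, continuous f}) /\
  match k with
  | 0 => True
  | j.+1 => forall v : V,
      (forall u, U u -> derivable f u v) /\ Ck_on j U (fun u => 'D_v f u)
  end.

Definition smooth_on (R : realType) (V W : normedModType R) (U : set V)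
  (f : V -> W) : Prop := forall k, Ck_on k U f.

(* [chart_map] is relevant only on [chart_dom], and [chart_inv] only on the
   image [chart_map @` chart_dom]. *)
Record chart (R : realType) (n : nat) (M : topologicalType) := Chart {
  chart_dom : set M;
  chart_map : M -> 'rV[R]_n;
  chart_inv : 'rV[R]_n -> M;
  chart_dom_open : open chart_dom;
  chart_img_open : open (chart_map @` chart_dom);
  chart_mapK : forall x, chart_dom x -> chart_inv (chart_map x) = x;
  chart_map_continuous : forall x, chart_dom x -> {for x, continuous chart_map};
  chart_inv_continuous :
    forall u, (chart_map @` chart_dom) u -> {for u, continuous chart_inv} }.

Definition chart_img (R : realType) (n : nat) (M : topologicalType)
  (c : chart R n M) : set 'rV[R]_n := chart_map c @` chart_dom c.

(* [chart_at x] is a preferred chart around [x], chosen once and for all.  It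
   identifies the tangent space T_x M with the space of row vectors 'rV[R]_n:
   a tangent vector at x is represented by its components in [chart_at x]. *)
Record manifold (R : realType) (n : nat) := Manifold {
  carrier :> topologicalType;
  atlas : set (chart R n carrier);
  chart_at : carrier -> chart R n carrier;
  manifold_hausdorff : hausdorff_space carrier;
  manifold_second_countable : @second_countable carrier;
  chart_at_atlas : forall x, atlas (chart_at x);
  chart_at_dom : forall x, chart_dom (chart_at x) x;
  atlas_compatible : forall c d, atlas c -> atlas d ->
    smooth_on (chart_map c @` (chart_dom c `&` chart_dom d))
              (chart_map d \o chart_inv c) }.

Section Manifold.
Variables (R : realType) (n : nat) (M : manifold R n).

Definition smooth_fun (f : M -> R) : Prop :=
  forall c, atlas c -> smooth_on (chart_img c) (f \o chart_inv c : _ -> R).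

(* The components, in the chart [c], of the tangent vector [v] at [x]. *)
Definition coords (c : chart R n M) (x : M) (v : 'rV[R]_n) : 'rV[R]_n :=
  'D_v (chart_map c \o chart_inv (chart_at x)) (chart_map (chart_at x) x).

(* The differential at [x] of a map [F : M -> M] (defined near [x]),
   from T_x M to T_(F x) M. *)
Definition tangent_map (F : M -> M) (x : M) (v : 'rV[R]_n) : 'rV[R]_n :=
  'D_v (chart_map (chart_at (F x)) \o F \o chart_inv (chart_at x))
       (chart_map (chart_at x) x).

(* [X x] is a tangent vector at [x]. *)
Definition vfield := M -> 'rV[R]_n.

Definition vf_in_chart (c : chart R n M) (X : vfield) :
    'rV[R]_n -> 'rV[R]_n :=
  fun u => coords c (chart_inv c u) (X (chart_inv c u)).

Definition smooth_vf_on (U : set M) (X : vfield) : Prop :=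
  forall c, atlas c ->
    smooth_on (chart_map c @` (chart_dom c `&` U)) (vf_in_chart c X).

Definition smooth_vf (X : vfield) : Prop := smooth_vf_on setT X.

Definition vf_apply (X : vfield) (f : M -> R) : M -> R :=
  fun x => 'D_(X x) (f \o chart_inv (chart_at x) : _ -> R)
             (chart_map (chart_at x) x).

(* [X, Y]^k = X^i d_i Y^k - Y^i d_i X^k in the chart [chart_at x]. *)
Definition lie_bracket (X Y : vfield) : vfield := fun x =>
  let c := chart_at x in
  'D_(X x) (vf_in_chart c Y) (chart_map c x)
  - 'D_(Y x) (vf_in_chart c X) (chart_map c x).

(* Only the values of [nabla] on smooth vector fields are meaningful. *)
Record linear_connection (nabla : vfield -> vfield -> vfield) : Prop := {
  connection_smooth : forall X Y, smooth_vf X -> smooth_vf Y ->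
    smooth_vf (nabla X Y);
  connection_linearl : forall f g X1 X2 Y,
    smooth_fun f -> smooth_fun g ->
    smooth_vf X1 -> smooth_vf X2 -> smooth_vf Y ->
    forall x, nabla (fun y => f y *: X1 y + g y *: X2 y) Y x =
              f x *: nabla X1 Y x + g x *: nabla X2 Y x;
  connection_addr : forall X Y1 Y2,
    smooth_vf X -> smooth_vf Y1 -> smooth_vf Y2 ->
    forall x, nabla X (fun y => Y1 y + Y2 y) x = nabla X Y1 x + nabla X Y2 x;
  connection_leibniz : forall f X Y,
    smooth_fun f -> smooth_vf X -> smooth_vf Y ->
    forall x, nabla X (fun y => f y *: Y y) x =
              f x *: nabla X Y x + vf_apply X f x *: Y x }.

Definition torsion (nabla : vfield -> vfield -> vfield) (X Y : vfield) :
  vfield := fun x => nabla X Y x - nabla Y X x - lie_bracket X Y x.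

Definition nonzero_torsion (nabla : vfield -> vfield -> vfield) : Prop :=
  exists X Y x, [/\ smooth_vf X, smooth_vf Y & torsion nabla X Y x <> 0].

(* [zeta] restricted to ]-e, e[ x U is a smooth map into M, and the
   t |-> zeta t y, for y in U, are the integral curves of [Z] with origin y. *)
Record local_flow (Z : vfield) (e : R) (U : set M) (zeta : R -> M -> M) :
    Prop := {
  flow_origin : forall y, U y -> zeta 0 y = y;
  flow_continuous : forall t y, `|t| < e -> U y ->
    {for (t, y), continuous (fun q : R * M => zeta q.1 q.2)};
  flow_smooth : forall c d, atlas c -> atlas d ->
    smooth_on
      [set q : R * 'rV[R]_n | [/\ `|q.1| < e,
         (chart_map c @` (chart_dom c `&` U)) q.2 &
         chart_dom d (zeta q.1 (chart_inv c q.2))]]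
      (fun q => chart_map d (zeta q.1 (chart_inv c q.2)));
  flow_integral : forall t y, `|t| < e -> U y ->
    is_derive t (1 : R) (fun s => chart_map (chart_at (zeta t y)) (zeta s y))
      (Z (zeta t y)) }.

(* [V s] is a tangent vector at [gamma s], where [gamma] is an integral curve
   of [Z]; the covariant derivative of [V] along [gamma] vanishes at [t].  It is
   computed by the Leibniz rule from a decomposition of [V] near [t] on the
   restrictions to [gamma] of vector fields [E i] on M, for which
   nabla_(gamma') (E i) is (nabla_Z (E i)) o gamma; the result does not depend
   on the decomposition, and one exists as soon as [V] is differentiable. *)
Definition parallel_at (nabla : vfield -> vfield -> vfield) (Z : vfield)
    (gamma : R -> M) (V : R -> 'rV[R]_n) (t : R) : Prop :=
  exists (m : nat) (E : 'I_m -> vfield) (f : 'I_m -> R -> R),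
    [/\ forall i, smooth_vf (E i),
        forall i, derivable (f i) t 1,
        \forall s \near t, V s = \sum_(i < m) f i s *: E i (gamma s) &
        \sum_(i < m) ('D_1 (f i) t *: E i (gamma t)
                      + f i t *: nabla Z (E i) (gamma t)) = 0].

(* [tau t] goes from the tangent space at [gamma 0] to that at [gamma t], with
   gamma an integral curve of [Z] on ]-e, e[. *)
Definition parallel_transport (nabla : vfield -> vfield -> vfield)
    (Z : vfield) (gamma : R -> M) (e : R) (tau : R -> 'End('rV[R]_n)) : Prop :=
  tau 0 = \1%VF /\
  forall xi t, `|t| < e ->
    parallel_at nabla Z gamma (fun s => tau s xi) t.

(* Parallel transport being bijective, [(tau t)^-1%VF] is its inverse. *)
Definition is_shape_map (nabla : vfield -> vfield -> vfield) (Z : vfield)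
    (A : M -> 'End('rV[R]_n)) : Prop :=
  forall x, exists e U zeta tau,
    [/\ 0 < e, open U /\ U x, local_flow Z e U zeta,
        parallel_transport nabla Z (zeta ^~ x) e tau &
        forall xi, is_derive (0 : R) (1 : R)
          (fun t => (tau t)^-1%VF (tangent_map (zeta t) x xi)) (A x xi)].

Definition smooth_distribution (p : nat) (D : M -> {vspace 'rV[R]_n}) : Prop :=
  forall x, exists (U : set M) (E : 'I_p -> vfield),
    [/\ open U, U x, forall i, smooth_vf_on U (E i) &
        forall y, U y -> basis_of (D y) [tuple E i y | i < p]].

Definition section_of (D : M -> {vspace 'rV[R]_n}) (X : vfield) : Prop :=
  smooth_vf X /\ forall x, X x \in D x.

Definition integrable_distribution (D : M -> {vspace 'rV[R]_n}) : Prop :=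
  forall X Y, section_of D X -> section_of D Y ->
    section_of D (lie_bracket X Y).

Definition complementary (D D' : M -> {vspace 'rV[R]_n}) : Prop :=
  forall x, (D x + D' x = fullv)%VS /\ (D x :&: D' x = 0)%VS.

Definition proj_top (D D' : M -> {vspace 'rV[R]_n}) (X : vfield) : vfield :=
  fun x => daddv_pi (D x) (D' x) (X x).

Definition proj_bot (D D' : M -> {vspace 'rV[R]_n}) (X : vfield) : vfield :=
  fun x => daddv_pi (D' x) (D x) (X x).

Definition second_form (nabla : vfield -> vfield -> vfield)
    (D D' : M -> {vspace 'rV[R]_n}) (X Y : vfield) : vfield :=
  proj_bot D D' (nabla X Y).

Definition bilinear_on (D : M -> {vspace 'rV[R]_n})
    (B : vfield -> vfield -> vfield) : Prop :=
  forall f g X1 X2 Y, smooth_fun f -> smooth_fun g ->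
    section_of D X1 -> section_of D X2 -> section_of D Y ->
    forall x,
      B (fun y => f y *: X1 y + g y *: X2 y) Y x =
        f x *: B X1 Y x + g x *: B X2 Y x /\
      B Y (fun y => f y *: X1 y + g y *: X2 y) x =
        f x *: B Y X1 x + g x *: B Y X2 x.

End Manifold.

(* Main.v *)
(* The point is the identity A_X(Y) = nabla_X Y - [X, Y]: for X, Y in D the
   bracket lies in D, whence items 1 and 4, while items 2 and 3 only use the
   connection axioms and the integrability of D.

   To prove it at x, write everything in the chart c around x.  Let zeta be the
   flow of X, P(t) the parallel transport tau_t, B(t) = tau_t^-1 (zeta_t* Y_x)
   and J(t) = zeta_t* Y_x, with values in T_(zeta_t x) M expressed in c, so that
   P(t) B(t) = J(t) and A_X(Y) = B'(0) = J'(0) - P'(0) Y_x.  By the symmetry of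
   second derivatives J'(0) is the derivative of the components of X along Y_x.
   A parallel field being given as a combination of restrictions of smooth
   fields E_i, P'(0) Y_x is minus a combination of the values of
   nabla_X - D_X on the E_i, D_X differentiating components in c.  This operator
   is tensorial at x (bump functions are needed here, as nabla only acts on
   global fields), so P'(0) Y_x = D_X Y - nabla_X Y. *)
Require Import Defs.
From HB Require Import structures.
From mathcomp Require Import all_boot all_order all_algebra.
From mathcomp Require Import all_classical all_reals all_analysis.
From mathcomp Require Import ring lra.

Set Implicit Arguments.
Unset Strict Implicit.
Unset Printing Implicit Defensive.

Import Order.TTheory GRing.Theory Num.Theory.
Import numFieldNormedType.Exports.

Local Open Scope classical_set_scope.
Local Open Scope ring_scope.

(** * Directional derivatives and C^k functions *)

Lemma is_derive_line (R : realType) (V W : normedModType R) (f : V -> W)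
    (x v : V) (t : R) :
  derivable f (t *: v + x) v ->
  is_derive t 1 (fun s : R => f (s *: v + x)) ('D_v f (t *: v + x)).
Proof.
move=> df.
have E : (fun h : R => h^-1 *: (((fun s : R => f (s *: v + x)) \o shift t) (h *: 1) -
    f (t *: v + x))) =
    (fun h => h^-1 *: ((f \o shift (t *: v + x)) (h *: v) - f (t *: v + x))).
  by apply/funext => h /=; rewrite scalerDl -addrA [h *: 1]mulr1.
by split; rewrite /derivable /derive /= E.
Qed.

(** Substituting [h * a] for [h] in the difference quotient gives homogeneity in the direction. The
    case [a = 0] is apart, since the substitution then leaves the punctured neighbourhood of 0. *)
Lemma is_derive_scale (R : realType) (V W : normedModType R) (f : V -> W)
    (x v : V) (a : R) :
  derivable f x v -> is_derive x (a *: v) f (a *: 'D_v f x).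
Proof.
move=> df.
have [->|a0] := eqVneq a 0; first by rewrite !scale0r; exact: is_derive0.
have cv : (fun h : R => h^-1 *: ((f \o shift x) (h *: (a *: v)) - f x)) @ 0^' -->
    a *: 'D_v f x.
  rewrite (_ : (fun h => _) = (fun h => a *: (h^-1 *: ((f \o shift x) (h *: v) - f x)))
     \o (fun h => h * a)); last first.
    apply/funext => h /=; rewrite !scalerA invfM mulrCA mulfV// mulr1//.
  apply: (@cvg_comp _ _ _ _ _ _ (0^' : set_system R)); last first.
    by apply: cvgZl_tmp; exact: df.
  move=> A /= [e /= e0 eA]; exists (e / `|a|) => /=.
    by rewrite divr_gt0// normr_gt0.
  move=> y /=; rewrite sub0r normrN => ye yN0; apply: eA => /=.
    by rewrite sub0r normrN normrM -ltr_pdivlMr// normr_gt0.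
  by rewrite mulf_neq0.
split; first by apply/cvg_ex; exists (a *: 'D_v f x).
exact: cvg_lim cv.
Qed.

Lemma MVT_line (R : realType) (V : normedModType R) (f : V -> R) (x v : V) :
  (forall s : R, 0 <= s <= 1 -> derivable f (s *: v + x) v) ->
  exists2 s : R, 0 <= s <= 1 & f (v + x) - f x = 'D_v f (s *: v + x).
Proof.
move=> df; pose g (s : R) := f (s *: v + x).
have dg (s : R) : 0 <= s <= 1 -> is_derive s 1 g ('D_v f (s *: v + x)).
  by move=> ?; apply: is_derive_line; exact: df.
have [||s sI] := @MVT_segment _ g (fun s => 'D_v f (s *: v + x)) 0 1 ler01.
- by move=> s; rewrite in_itv/= => /andP[/ltW s0 /ltW s1]; apply: dg; rewrite s0.
- by apply: derivable_within_continuous => s; rewrite in_itv/= => /dg[].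
rewrite subr0 mulr1 /g scale0r add0r scale1r => ->.
by exists s => //; move: sI; rewrite in_itv.
Qed.

Lemma Ck_onP (R : realType) (V W : normedModType R) k (U : set V)
    (f : V -> W) (v : V) : Ck_on k.+1 U f ->
  (forall u, U u -> derivable f u v) /\ Ck_on k U ('D_v f).
Proof. by case=> _ /(_ v). Qed.

Lemma Ck_onS (R : realType) (V W : normedModType R) k (U U' : set V)
    (f : V -> W) :
  U' `<=` U -> Ck_on k U f -> Ck_on k U' f.
Proof.
elim: k f => [|k IH] f UU /= [cf df]; split=> //; do ?by move=> u /UU/cf.
move=> v.
by have [df1 df2] := df v; split=> [u /UU/df1 //|]; exact: IH.
Qed.

Lemma Ck_on_local (R : realType) (V W : normedModType R) k (U : set V)
    (f : V -> W) :
  (forall u, U u -> exists2 U', U' u & Ck_on k U' f) -> Ck_on k U f.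
Proof.
elim: k f => [|k IH] f UU; split=> //;
  do ?by move=> u /UU[U' U'u [cf _]]; exact: cf.
move=> v.
split=> [u /UU[U' U'u [_ df]]|]; first exact: (df v).1.
by apply: IH => u /UU[U' U'u [_ df]]; exists U' => //; exact: (df v).2.
Qed.

(** As [U] is open, agreement on [U] is agreement near each of its points. The derivatives therefore
    agree on [U] as well, and the induction on [k] goes through. *)
Lemma Ck_on_eq (R : realType) (V W : normedModType R) k (U : set V)
    (f g : V -> W) :
  open U -> (forall u, U u -> f u = g u) -> Ck_on k U f -> Ck_on k U g.
Proof.
move=> oU; have nU u : U u -> \near u, U u by move=> Uu; exact: open_nbhs_nbhs.
elim: k f g => [|k IH] f g fg [cf df].
  split=> // u Uu; rewrite /prop_for /continuous_at -fg//.
  apply: cvg_trans (cf u Uu).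
  by apply: near_eq_cvg; apply: filterS (nU u Uu) => y /fg.
split=> [u Uu|v].
  rewrite /prop_for /continuous_at -fg//; apply: cvg_trans (cf u Uu).
  by apply: near_eq_cvg; apply: filterS (nU u Uu) => y /fg.
have E u : U u -> \near u, f u = g u by move=> /nU; exact: filterS.
split=> [u Uu|]; first by apply: near_eq_derivable (E u Uu) _; exact: (df v).1.
apply: IH (df v).2 => u Uu; exact: near_eq_derive (E u Uu).
Qed.

Lemma Ck_onSk (R : realType) (V W : normedModType R) k (U : set V)
    (f : V -> W) : Ck_on k.+1 U f -> Ck_on k U f.
Proof.
elim: k f => [|k IH] f [cf df]; split=> // v.
by have [df1 df2] := df v; split=> //; exact: IH.
Qed.

Lemma Ck_on_cst (R : realType) (V W : normedModType R) k (U : set V) (w : W) :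
  Ck_on k U (fun=> w).
Proof.
elim: k w => [|k IH] w; split=> //; do ?by move=> u _; exact: cvg_cst.
move=> v.
split=> [u _|]; first exact: derivable_cst.
have -> : (fun u => 'D_v (fun=> w) u) = (fun=> 0).
  by apply/funext => u; exact: derive_cst.
exact: IH.
Qed.

Lemma Ck_onD (R : realType) (V W : normedModType R) k (U : set V)
    (f g : V -> W) : open U ->
  Ck_on k U f -> Ck_on k U g -> Ck_on k U (fun u => f u + g u).
Proof.
move=> oU; elim: k f g => [|k IH] f g [cf df] [cg dg]; split=> //;
  do ?by move=> u Uu; apply: cvgD; [exact: cf | exact: cg].
move=> v.
have [df1 df2] := df v; have [dg1 dg2] := dg v.
split=> [u Uu|]; first by apply: derivableD; [exact: df1 | exact: dg1].
apply: Ck_on_eq (IH _ _ df2 dg2) => // u Uu.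
by rewrite [RHS]deriveD; [|exact: df1|exact: dg1].
Qed.

Lemma Ck_onM (R : realType) (V : normedModType R) k (U : set V)
    (f g : V -> R) : open U ->
  Ck_on k U f -> Ck_on k U g -> Ck_on k U (fun u => f u * g u).
Proof.
move=> oU; elim: k f g => [|k IH] f g Cf Cg.
  by split=> // u Uu; apply: cvgM; [exact: Cf.1|exact: Cg.1].
split=> [u Uu|v]; first by apply: cvgM; [exact: Cf.1|exact: Cg.1].
have [df1 df2] := Ck_onP v Cf; have [dg1 dg2] := Ck_onP v Cg.
split=> [u Uu|]; first by apply: derivableM; [exact: df1 | exact: dg1].
have H := Ck_onD oU (IH _ _ (Ck_onSk Cf) dg2) (IH _ _ (Ck_onSk Cg) df2).
apply: Ck_on_eq H => // u Uu.
by rewrite [RHS]deriveM; [|exact: df1|exact: dg1].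
Qed.

Lemma Ck_on_sum (R : realType) (V W : normedModType R) k (U : set V) m
    (f : 'I_m -> V -> W) : open U ->
  (forall i, Ck_on k U (f i)) -> Ck_on k U (fun u => \sum_(i < m) f i u).
Proof.
move=> oU; elim: m f => [|m IH] f Cf.
  by under eq_fun do rewrite big_ord0; exact: Ck_on_cst.
by under eq_fun do rewrite big_ord_recr /=; apply: Ck_onD => //; apply: IH.
Qed.

Lemma Ck_on_coord (R : realType) (V : normedModType R) k n (U : set V)
    (f : V -> 'rV[R]_n) : open U ->
  Ck_on k U f <-> forall j, Ck_on k U (fun u => f u 0 j).
Proof.
move=> oU; elim: k f => [|k IH] f.
  split=> [[cf _] j|cf]; split=> // u Uu.
    apply: (@continuous_comp _ _ _ f (fun M : 'rV[R]_n => M 0 j) u (cf u Uu)).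
    exact: coord_continuous.
  apply/cvgrPdist_le => e e0; near=> y.
  rewrite /Num.Def.normr/= mx_normrE (bigmax_le _ (ltW e0))// => -[i j] _.
  rewrite !mxE/= ord1; move: j; near: y; apply: filter_forall => j.
  by have := (cf j).1 u Uu => /cvgrPdist_le /(_ _ e0).
have E v u j : derivable f u v -> ('D_v f u) 0 j = 'D_v (fun u => f u 0 j) u.
  by move=> d; rewrite derive_mx// mxE.
split=> [Cf j|Cf].
  split=> [u Uu|v].
    apply: (@continuous_comp _ _ _ f (fun M : 'rV[R]_n => M 0 j) u (Cf.1 u Uu)).
    exact: coord_continuous.
  have [df1 df2] := Ck_onP v Cf.
  split=> [u Uu|]; first by have /derivable_mxP := df1 u Uu; exact.
  have /IH/(_ j) := df2; apply: Ck_on_eq => // u Uu; apply: E; exact: df1.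
split=> [|v].
  (* Continuity of [f] is read off from its class at order [k], which the induction hypothesis
     provides. *)
  suff : Ck_on k U f by case: (k) => [|?] [].
  by apply/IH => j; exact: Ck_onSk.
have df1 u : U u -> derivable f u v.
  by move=> Uu; apply/derivable_mxP => i j; rewrite ord1; exact: (Ck_onP v (Cf j)).1.
split=> //; apply/IH => j.
apply: Ck_on_eq (Ck_onP v (Cf j)).2 => // u Uu; rewrite E//; exact: df1.
Unshelve. all: by end_near. Qed.

Lemma Ck_on_id (R : realType) (V : normedModType R) k (U : set V) :
  Ck_on k U (id : V -> V).
Proof.
case: k => [|k]; split=> //; do ?by move=> u _; exact: cvg_id.
move=> v; split=> [u _|]; first exact: derivable_id.
by under eq_fun do rewrite derive_id; exact: Ck_on_cst.
Qed.

(** [Ck_on] speaks of one direction at a time, so additivity in the direction has to be derived.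
    Move along [h *: v], then along [h *: w]: by the mean value theorem the second increment is [h]
    times ['D_w f] at a nearby point, and ['D_w f] is continuous. *)
Lemma Ck1_deriveD (R : realType) (V : normedModType R) (U : set V)
    (f : V -> R) (y v w : V) : open U -> Ck_on 1 U f -> U y ->
  'D_(v + w) f y = 'D_v f y + 'D_w f y.
Proof.
move=> oU Cf Uy.
have [dv _] := Ck_onP v Cf; have [dw [cw _]] := Ck_onP w Cf.
apply: cvg_lim => //.
have -> : (fun h : R => h^-1 *: ((f \o shift y) (h *: (v + w)) - f y)) =
    (fun h => h^-1 *: ((f \o shift y) (h *: v) - f y)) \+
    (fun h => h^-1 *: (f (h *: w + (h *: v + y)) - f (h *: v + y))).
  apply/funext => h /=; rewrite -scalerDr; congr (_ *: _).
  by rewrite [RHS]addrC subrKA scalerDr [h *: v + _]addrC addrA.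
apply: cvgD; first exact: dv.
apply/cvgrPdist_le => e e0.
have : \forall z \near y, U z /\ `|'D_w f y - 'D_w f z| <= e.
  near=> z; split; first by near: z; exact: open_nbhs_nbhs.
  by near: z; have /cvgrPdist_le/(_ _ e0) := cw y Uy.
move=> /nbhs_ballP[d /= d0 dP].
(* The two moves together have length at most |h| (|v| + |w|); the added 1 keeps the divisor
   positive when [v] and [w] are both 0. *)
have K0 : 0 < `|v| + `|w| + 1 by rewrite ltr_wpDl// addr_ge0.
near=> h.
have hN0 : h != 0 by near: h; exact: nbhs_dnbhs_neq.
have hd : `|h| < d / (`|v| + `|w| + 1).
  by near: h; apply: dnbhs0_lt; rewrite divr_gt0.
have H (s : R) : 0 <= s <= 1 ->
    U (s *: (h *: w) + (h *: v + y)) /\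
    `|'D_w f y - 'D_w f (s *: (h *: w) + (h *: v + y))| <= e.
  move=> /andP[s0 s1]; apply: dP; rewrite -ball_normE /ball_/=.
  rewrite addrA opprD addrCA subrr addr0 normrN.
  apply: le_lt_trans (ler_normD _ _) _.
  rewrite scalerA !normrZ (ger0_norm s0).
  apply: (@le_lt_trans _ _ (`|h| * (`|v| + `|w| + 1))); last by rewrite -ltr_pdivlMr.
  rewrite -mulrA !mulrDr mulr1 addrC -addrA lerD2l.
  apply: ler_wpDr => //; apply: ler_piMl => //; exact: mulr_ge0.
have [|s sI ->] := @MVT_line _ _ f (h *: v + y) (h *: w).
  move=> s /H[Us _]; by have [] := is_derive_scale h (dw _ Us).
have [Us Hs] := H _ sI.
have [_ ->] := is_derive_scale h (dw _ Us).
by rewrite [h^-1 *: _]scalerA mulVf// scale1r.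
Unshelve. all: by end_near. Qed.

Lemma Ck1_derive_sum (R : realType) (V : normedModType R) (U : set V)
    (f : V -> R) (y : V) m (a : 'I_m -> R) (v : 'I_m -> V) :
  open U -> Ck_on 1 U f -> U y ->
  'D_(\sum_(i < m) a i *: v i) f y = \sum_(i < m) a i * 'D_(v i) f y.
Proof.
move=> oU Cf Uy; elim: m a v => [|m IH] a v.
  by rewrite !big_ord0 derive0.
rewrite !big_ord_recr/= (Ck1_deriveD _ _ oU Cf Uy) IH; congr (_ + _).
by have [_ ->] := is_derive_scale (a ord_max) ((Ck_onP (v ord_max) Cf).1 y Uy).
Qed.

Lemma Ck1_derive_row (R : realType) n (U : set 'rV[R]_n)
    (f : 'rV[R]_n -> R) (y v : 'rV[R]_n) :
  open U -> Ck_on 1 U f -> U y ->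
  'D_v f y = \sum_(k < n) v 0 k * 'D_(delta_mx 0 k) f y.
Proof.
by move=> oU Cf Uy; rewrite [v in LHS]row_sum_delta (Ck1_derive_sum _ _ oU Cf Uy).
Qed.

(* The difference quotient of [f \o g] is [D_(q h) f (z h)], where [q h] is the
   difference quotient of [g] and [z h] lies between [g t] and [g (t + h)]. *)
Lemma is_derive_curve_real (R : realType) n (U : set 'rV[R]_n)
    (f : 'rV[R]_n -> R) (g : R -> 'rV[R]_n) (t : R) (v : 'rV[R]_n) :
  open U -> Ck_on 1 U f -> U (g t) -> is_derive t 1 g v ->
  is_derive t 1 (f \o g) ('D_v f (g t)).
Proof.
move=> oU Cf Ug [dg gv].
pose q (h : R) := h^-1 *: ((g \o shift t) (h *: 1) - g t).
have qv : q @ 0^' --> v by rewrite -gv; exact: dg.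
(* The derivative of [f] as a function of direction and point together. Expanded on the basis it is
   visibly jointly continuous, which matters because [q h] and the intermediate point both vary with
   [h]. *)
pose Phi (p : 'rV[R]_n * 'rV[R]_n) :=
  \sum_(k < n) p.1 0 k * 'D_(delta_mx 0 k) f p.2.
have PhiE d z : U z -> 'D_d f z = Phi (d, z).
  by move=> Uz; rewrite (Ck1_derive_row _ oU Cf Uz).
have cPhi : {for (v, g t), continuous Phi}.
  apply: cvg_big => [|k _]; first exact: add_continuous.
  apply: cvgM.
    apply: (@continuous_comp _ _ _ fst (fun M : 'rV[R]_n => M 0 k)); first exact: cvg_fst.
    exact: coord_continuous.
  apply: (@continuous_comp _ _ _ snd ('D_(delta_mx 0 k) f)); first exact: cvg_snd.
  exact: (Ck_onP (delta_mx 0 k) Cf).2.1.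
have cv : (fun h : R => h^-1 *: (((f \o g) \o shift t) (h *: 1) - (f \o g) t)) @ 0^'
    --> 'D_v f (g t).
  apply/cvgrPdist_le => e e0.
  have : \forall p \near (v, g t), U p.2 /\ `|Phi (v, g t) - Phi p| <= e.
    near=> p; split; first by near: p; apply: cvg_snd; exact: open_nbhs_nbhs.
    by near: p; move: cPhi => /cvgrPdist_le/(_ _ e0).
  move=> /nbhs_ballP[d /= d0 dP].
  have K0 : 0 < `|v| + d + 1 by rewrite ltr_wpDl// addr_ge0// ltW.
  near=> h.
  have hN0 : h != 0 by near: h; exact: nbhs_dnbhs_neq.
  have hd : `|h| < d / (`|v| + d + 1).
    by near: h; apply: dnbhs0_lt; rewrite divr_gt0.
  have hq : `|v - q h| < d by near: h; move: qv => /cvgrPdist_lt/(_ _ d0).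
  have gE : g (h *: 1 + t) = h *: q h + g t.
    by rewrite /q scalerA mulfV// scale1r/= subrK.
  have H (s : R) : 0 <= s <= 1 -> U (s *: (h *: q h) + g t) /\
      `|Phi (v, g t) - Phi (q h, s *: (h *: q h) + g t)| <= e.
    move=> /andP[s0 s1]; apply: (dP (_, _)); split; first by rewrite -ball_normE.
    rewrite -ball_normE /ball_/= opprD addrCA subrr addr0 normrN.
    rewrite scalerA normrZ normrM (ger0_norm s0).
    have q1 : `|q h| <= `|v| + d.
      rewrite -(subKr v (q h)); apply: le_trans (ler_normB _ _) _.
      by rewrite lerD2l ltW.
    apply: (@le_lt_trans _ _ (`|h| * (`|v| + d + 1))); last by rewrite -ltr_pdivlMr.
    apply: ler_pM => //; first exact: mulr_ge0.
      exact: ler_piMl.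
    by apply: le_trans q1 _; rewrite lerDl.
  rewrite /= gE.
  have [|s sI ->] := @MVT_line _ _ f (g t) (h *: q h).
    by move=> s /H[Us _]; have [] := is_derive_scale h ((Ck_onP (q h) Cf).1 _ Us).
  have [Us Hs] := H _ sI.
  have [_ ->] := is_derive_scale h ((Ck_onP (q h) Cf).1 _ Us).
  by rewrite [h^-1 *: _]scalerA mulVf// scale1r !PhiE.
by split; [apply/cvg_ex; exists ('D_v f (g t)) | exact: cvg_lim cv].
Unshelve. all: by end_near. Qed.

(** * Chain rules and composites of C^k maps *)

Lemma is_derive1P (R : realType) (V W : normedModType R) (f : V -> W)
    (x v : V) (df : W) :
  is_derive x v f df <-> is_derive 0 (1 : R) (fun h : R => f (h *: v + x)) df.
Proof.
have E : (fun h : R => h^-1 *: (((fun s : R => f (s *: v + x)) \o shift 0) (h *: 1) -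
    f ((0 : R) *: v + x))) = (fun h => h^-1 *: ((f \o shift x) (h *: v) - f x)).
  by apply/funext => h /=; rewrite addr0 scale0r add0r [h *: 1]mulr1.
by split=> -[]; rewrite /derivable /derive ?E => d e; split;
  rewrite /derivable /derive ?E.
Qed.

Lemma is_derive_rV (R : realType) (V : normedModType R) m (f : V -> 'rV[R]_m)
    (x v : V) (df : 'rV[R]_m) :
  is_derive x v f df <-> forall j, is_derive x v (fun y => f y 0 j) (df 0 j).
Proof.
split=> [[d <-] j|H].
  by split; [move/derivable_mxP: d; exact | rewrite derive_mx// mxE].
have d : derivable f x v.
  by apply/derivable_mxP => i j; rewrite ord1; exact: (@ex_derive _ _ _ _ _ _ _ (H j)).
by split=> //; apply/rowP => j; rewrite derive_mx// mxE; exact: derive_val.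
Qed.

Lemma is_derive_comp_real (R : realType) (V : normedModType R) n
    (U : set 'rV[R]_n) (f : 'rV[R]_n -> R) (g : V -> 'rV[R]_n)
    (x v : V) (dg : 'rV[R]_n) :
  open U -> Ck_on 1 U f -> U (g x) -> is_derive x v g dg ->
  is_derive x v (f \o g) ('D_dg f (g x)).
Proof.
move=> oU Cf Ug /is_derive1P H; apply/is_derive1P.
rewrite -[x in X in is_derive _ _ _ X]add0r -(scale0r v).
by apply: is_derive_curve_real oU Cf _ H; rewrite scale0r add0r.
Qed.

Lemma is_derive_comp (R : realType) (V : normedModType R) n m
    (U : set 'rV[R]_n) (f : 'rV[R]_n -> 'rV[R]_m) (g : V -> 'rV[R]_n)
    (x v : V) (dg : 'rV[R]_n) :
  open U -> Ck_on 1 U f -> U (g x) -> is_derive x v g dg ->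
  is_derive x v (f \o g) ('D_dg f (g x)).
Proof.
move=> oU Cf Ug H; apply/is_derive_rV => j.
have Cj := (Ck_on_coord 1 f oU).1 Cf j.
have := is_derive_comp_real oU Cj Ug H.
by rewrite derive_mx ?mxE//; exact: (Ck_onP dg Cf).1.
Qed.

Lemma Ck1_derive_sum_rV (R : realType) (V : normedModType R) n (U : set V)
    (f : V -> 'rV[R]_n) (y : V) m (a : 'I_m -> R) (v : 'I_m -> V) :
  open U -> Ck_on 1 U f -> U y ->
  'D_(\sum_(i < m) a i *: v i) f y = \sum_(i < m) a i *: 'D_(v i) f y.
Proof.
move=> oU Cf Uy; apply/rowP => j.
rewrite derive_mx; last exact: (Ck_onP _ Cf).1.
rewrite mxE (Ck1_derive_sum _ _ oU ((Ck_on_coord 1 f oU).1 Cf j) Uy) summxE.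
apply: eq_bigr => i _; rewrite mxE derive_mx ?mxE//; exact: (Ck_onP _ Cf).1.
Qed.

(** Induction on [k]: by the chain rule the derivative of the composite along [v] is the sum over
    [j] of ('D_v g)_j times (d_j f) o g, whose factors are of class C^k. *)
Lemma Ck_on_comp_real (R : realType) (V : normedModType R) n k (U : set V)
    (U' : set 'rV[R]_n) (f : 'rV[R]_n -> R) (g : V -> 'rV[R]_n) :
  open U -> open U' -> (forall u, U u -> U' (g u)) ->
  Ck_on k U' f -> Ck_on k U g -> Ck_on k U (f \o g).
Proof.
move=> oU oU' UU'; elim: k f => [|k IH] f Cf Cg.
  split=> // u Uu; apply: continuous_comp; first exact: Cg.1.
  exact: Cf.1 (UU' _ Uu).
split=> [u Uu|v].
  by apply: continuous_comp; [exact: Cg.1 | exact: Cf.1 (UU' _ Uu)].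
have C1f : Ck_on 1 U' f.
  by case: (k) Cf => [//|k']; elim: k' => [|k' H] ?; [exact: Ck_onSk|exact/H/Ck_onSk].
have [dg Cdg] := Ck_onP v Cg.
have D u : U u -> is_derive u v (f \o g) ('D_('D_v g u) f (g u)).
  move=> Uu; apply: is_derive_comp_real oU' C1f (UU' _ Uu) _.
  exact: derivableP (dg u Uu).
split=> [u /D[]//|].
have H : Ck_on k U (fun u => \sum_(j < n) 'D_v g u 0 j *
    ('D_(delta_mx 0 j) f \o g) u).
  apply: Ck_on_sum => // j; apply: Ck_onM => //.
    exact: (Ck_on_coord k _ oU).1.
  by apply: IH (Ck_onSk Cg); exact: (Ck_onP _ Cf).2.
apply: Ck_on_eq H => // u Uu.
by have [_ ->] := D u Uu; rewrite -(Ck1_derive_row _ oU' C1f)//; exact: UU'.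
Qed.

Lemma Ck_on_comp (R : realType) (V : normedModType R) n m k (U : set V)
    (U' : set 'rV[R]_n) (f : 'rV[R]_n -> 'rV[R]_m) (g : V -> 'rV[R]_n) :
  open U -> open U' -> (forall u, U u -> U' (g u)) ->
  Ck_on k U' f -> Ck_on k U g -> Ck_on k U (f \o g).
Proof.
move=> oU oU' UU' Cf Cg; apply/(Ck_on_coord k _ oU) => j.
exact: (Ck_on_comp_real oU oU' UU' ((Ck_on_coord k f oU').1 Cf j) Cg).
Qed.

(** * Symmetry of second derivatives *)

(** The mean value theorem is applied twice: along [a] to the increment y |-> f (b + y) - f y, then
    along [b] to ['D_a f]. *)
Lemma second_difference (R : realType) (V : normedModType R) (U : set V)
    (f : V -> R) (x a b : V) :
  open U -> Ck_on 2 U f ->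
  (forall s t : R, 0 <= s <= 1 -> 0 <= t <= 1 -> U (t *: b + (s *: a + x))) ->
  exists s t : R, [/\ 0 <= s <= 1, 0 <= t <= 1 &
    f (b + (a + x)) - f (a + x) - (f (b + x) - f x) =
    'D_b ('D_a f) (t *: b + (s *: a + x))].
Proof.
move=> oU Cf H.
pose G y := f (b + y) - f y.
have I0 : 0 <= (0 : R) <= 1 by rewrite lexx ler01.
have I1 : 0 <= (1 : R) <= 1 by rewrite lexx ler01.
have [da Ca] := Ck_onP a Cf.
have dG (s : R) : 0 <= s <= 1 -> is_derive (s *: a + x) a G
    ('D_a f (b + (s *: a + x)) - 'D_a f (s *: a + x)).
  move=> sI; apply: is_deriveB; last first.
    by apply/derivableP/da; have := H s 0 sI I0; rewrite scale0r add0r.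
  apply/is_derive1P.
  have := H s 1 sI I1; rewrite scale1r => U1.
  have /derivableP/is_derive1P := da _ U1.
  by under eq_fun do rewrite addrCA.
have [s sI GE] : exists2 s : R, 0 <= s <= 1 & G (a + x) - G x = 'D_a G (s *: a + x).
  by apply: MVT_line => s /dG[].
have [_ dGs] := dG s sI.
have [t tI E] : exists2 t : R, 0 <= t <= 1 &
    'D_a f (b + (s *: a + x)) - 'D_a f (s *: a + x) =
    'D_b ('D_a f) (t *: b + (s *: a + x)).
  apply: (@MVT_line _ _ ('D_a f)) => t tI; apply: (Ck_onP b Ca).1; exact: H.
exists s, t; split=> //.
by rewrite -E -dGs -GE /G.
Qed.

Lemma ball_dist_le (R : realType) (V : normedModType R) (U : set V)
    (f g : V -> R) (x : V) (e : R) :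
  open U -> U x -> {for x, continuous f} -> {for x, continuous g} -> 0 < e ->
  exists2 d : R, 0 < d & forall z, ball x d z ->
    [/\ U z, `|f x - f z| <= e & `|g x - g z| <= e].
Proof.
move=> oU Ux cf cg e0.
have : \forall z \near x, [/\ U z, `|f x - f z| <= e & `|g x - g z| <= e].
  near=> z; split; first by near: z; exact: open_nbhs_nbhs.
    by near: z; move: cf => /cvgrPdist_le/(_ _ e0).
  by near: z; move: cg => /cvgrPdist_le/(_ _ e0).
by move=> /nbhs_ballP[d /= d0 dP]; exists d.
Unshelve. all: by end_near. Qed.

(** Both equations have the same second difference on the left, with its terms grouped differently.
    Dividing by [h * h] gives [P = Q], and the triangle inequality concludes. *)
Lemma second_difference_close (R : realType) (h e A B P Q p0 p1 p2 p3 : R) :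
  h != 0 -> p3 - p2 - (p1 - p0) = h * h * P -> p3 - p1 - (p2 - p0) = h * h * Q ->
  `|A - Q| <= e / 2 -> `|B - P| <= e / 2 -> `|A - B| <= e.
Proof.
move=> h0 EP EQ AQ BP.
have PQ : P = Q.
  apply: (@mulfI _ (h * h)); first by rewrite mulf_neq0.
  by rewrite -EP -EQ; ring.
rewrite PQ distrC in BP; rewrite (splitr e) -(subrKA Q).
by apply: le_trans (ler_normD _ _) _; exact: lerD.
Qed.

(** The second difference over a small parallelogram with sides [h *: a] and [h *: b] is expressed
    by either mixed derivative at some point of it. Continuity brings both values within [e / 2] of
    those at [x]. *)
Lemma deriveC_real (R : realType) (V : normedModType R) (U : set V)
    (f : V -> R) (x a b : V) : open U -> Ck_on 2 U f -> U x ->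
  'D_a ('D_b f) x = 'D_b ('D_a f) x.
Proof.
move=> oU Cf Ux; apply/eqP; rewrite -subr_eq0 -normr_le0; apply/ler_addgt0Pr => e e0.
rewrite add0r.
have cab : {for x, continuous ('D_a ('D_b f))} by exact: (Ck_onP a (Ck_onP b Cf).2).2.1.
have cba : {for x, continuous ('D_b ('D_a f))} by exact: (Ck_onP b (Ck_onP a Cf).2).2.1.
have e2 : 0 < e / 2 by rewrite divr_gt0.
have [d d0 dP] := ball_dist_le oU Ux cab cba e2.
have K0 : 0 < `|a| + `|b| + 1 by rewrite ltr_wpDl// addr_ge0.
(* The witness is half of the bound, to get a strict inequality; it keeps the whole parallelogram
   inside the ball of radius [d]. *)
have [h h0 hd] : exists2 h : R, 0 < h & h * (`|a| + `|b| + 1) < d.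
  exists (d / (`|a| + `|b| + 1) / 2); first by rewrite !divr_gt0.
  by rewrite mulrAC divfK ?gt_eqF// ltr_pdivrMr// ltr_pMr// ltr1n.
have B (s t : R) : 0 <= s <= 1 -> 0 <= t <= 1 ->
    ball x d (t *: (h *: b) + (s *: (h *: a) + x)).
  move=> /andP[s0 s1] /andP[t0 t1]; rewrite -ball_normE /ball_/=.
  rewrite addrA opprD addrCA subrr addr0 normrN.
  apply: le_lt_trans (ler_normD _ _) _; apply: le_lt_trans hd.
  rewrite !normrZ (ger0_norm s0) (ger0_norm t0) (gtr0_norm h0) !mulrDr mulr1.
  rewrite addrC -addrA lerD ?ler_piMl ?mulr_ge0 ?(ltW h0)//.
  by rewrite ler_wpDr ?ler_piMl ?mulr_ge0 ?(ltW h0).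
have DD u v z : U z -> 'D_(h *: u) ('D_(h *: v) f) z = h * h * 'D_u ('D_v f) z.
  move=> Uz; have [dv Cv] := Ck_onP v Cf.
  have -> : 'D_(h *: u) ('D_(h *: v) f) z = 'D_(h *: u) (h *: 'D_v f) z.
    apply: near_eq_derive; near=> y.
    have Uy : U y by near: y; exact: open_nbhs_nbhs.
    by have [_ ->] := is_derive_scale h (dv y Uy).
  rewrite deriveZ; last exact: (Ck_onP _ Cv).1.
  have [_ ->] := is_derive_scale h ((Ck_onP u Cv).1 z Uz).
  by rewrite -mulrA.
have [s [t [sI tI E]]] := @second_difference _ _ U f x (h *: a) (h *: b) oU Cf
  (fun s t sI tI => let: And3 u _ _ := dP _ (B s t sI tI) in u).
have B' (s' t' : R) : 0 <= s' <= 1 -> 0 <= t' <= 1 ->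
    ball x d (t' *: (h *: a) + (s' *: (h *: b) + x)).
  by move=> sI' tI'; rewrite addrCA; exact: B.
have [s' [t' [sI' tI' E']]] := @second_difference _ _ U f x (h *: b) (h *: a) oU Cf
  (fun s t sI tI => let: And3 u _ _ := dP _ (B' s t sI tI) in u).
have [Uz z1 z2] := dP _ (B s t sI tI).
have [Uz' z1' z2'] := dP _ (B' s' t' sI' tI').
rewrite DD// in E; rewrite DD// in E'.
rewrite (addrCA (h *: a) (h *: b) x) in E'.
exact: second_difference_close (lt0r_neq0 h0) E E' z1' z2.
Unshelve. all: by end_near. Qed.

Lemma deriveC (R : realType) (V : normedModType R) m (U : set V)
    (f : V -> 'rV[R]_m) (x a b : V) : open U -> Ck_on 2 U f -> U x ->
  'D_a ('D_b f) x = 'D_b ('D_a f) x.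
Proof.
move=> oU Cf Ux; apply/rowP => j.
have E u v : ('D_u ('D_v f) x) 0 j = 'D_u ('D_v (fun y => f y 0 j)) x.
  have [dv Cv] := Ck_onP v Cf.
  rewrite derive_mx; last exact: (Ck_onP _ Cv).1.
  rewrite mxE; apply: near_eq_derive; near=> y.
  have Uy : U y by near: y; exact: open_nbhs_nbhs.
  by rewrite derive_mx ?mxE//; exact: dv.
have Cj := (Ck_on_coord 2 f oU).1 Cf j.
have H := deriveC_real a b oU Cj Ux.
exact: etrans (E a b) (etrans H (esym (E b a))).
Unshelve. all: by end_near. Qed.

(** * A flat function *)

Section flat_function.
Variable R : realType.

(* For [p] a polynomial, p(1/t) exp(-1/t) for t > 0, extended by 0: this family
   is stable under derivation. *)
Definition flat (p : {poly R}) (t : R) : R :=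
  if 0 < t then p.[t^-1] * expR (- t^-1) else 0.

Lemma flat_le0 (p : {poly R}) (t : R) : t <= 0 -> flat p t = 0.
Proof. by rewrite /flat leNgt; case: ifP. Qed.

(** For t > 0, exp(1/t) is at least (1/t)^(i+1) / (i+1)!, so the monomial (1/t)^i exp(-1/t) is at
    most (i+1)! t. The spare factor t is what makes the functions differentiable at 0. *)
Lemma flat_bound (p : {poly R}) : exists C : R, forall t, `|flat p t| <= C * `|t|.
Proof.
exists (\sum_(i < size p) `|p`_i| * (i.+1)`!%:R) => t.
have [t0|t0] := ltP 0 t; last first.
  by rewrite flat_le0// normr0 mulr_ge0// sumr_ge0// => i _; rewrite mulr_ge0.
rewrite /flat t0 horner_coef normrM (ger0_norm (expR_ge0 _)) !mulr_suml.
apply: le_trans (_ : \sum_(i < size p) `|p`_i * t^-1 ^+ i| * expR (- t^-1) <= _).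
  by rewrite -mulr_suml ler_wpM2r ?expR_ge0// ler_norm_sum.
apply: ler_sum => i _; rewrite normrM -!mulrA ler_wpM2l//.
have ti : 0 < t^-1 by rewrite invr_gt0.
rewrite ger0_norm ?exprn_ge0 ?(ltW ti)// (gtr0_norm t0).
have fp : 0 < (i.+1)`!%:R :> R by rewrite ltr0n fact_gt0.
rewrite expRN ler_pdivrMr ?expR_gt0//.
have := expR_ge1Dxn i (ltW ti) => H.
rewrite -mulrA -ler_pdivrMl//.
apply: le_trans (_ : t * (1 + t^-1 ^+ i.+1 / (i.+1)`!%:R) <= _); last first.
  by rewrite ler_pM2l.
rewrite mulrDr mulr1 exprS -mulrA mulVKf ?gt_eqF// mulrC lerDr; exact: ltW.
Qed.

(** For t > 0 put s = 1/t, so ds/dt = - s^2 and p(s) exp(-s) has derivative s^2 (p - p')(s) exp(-s).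
    At 0 the difference quotient of [flat p] is [flat ('X * p)], which tends to 0 by
    [flat_bound]. *)
Lemma is_derive_flat (p : {poly R}) (t : R) :
  is_derive t 1 (flat p) (flat ('X^2 * (p - p^`())) t).
Proof.
have [t0|t0|->] := ltgtP t 0.
- rewrite flat_le0 ?ltW//; apply: (@near_eq_is_derive _ _ _ (cst 0)).
  near=> s; rewrite flat_le0//; apply: ltW; near: s; exact: lt_nbhsl.
- have tN0 : t != 0 by rewrite gt_eqF.
  have dV : is_derive t (1 : R) (fun s : R => s^-1) (- t ^- 2).
    have := @is_deriveV _ id t 1 1 tN0 (is_derive_id _ _).
    by rewrite /GRing.scale/= mulr1.
  have dE : is_derive t (1 : R) (fun s : R => expR (- s^-1)) (expR (- t^-1) * t ^- 2).
    have := @is_derive1_comp _ expR (fun s => - s^-1) t _ _ (is_derive_expR _) (is_deriveN dV).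
    by rewrite opprK mulrC.
  have dp : is_derive t (1 : R) (fun s : R => p.[s^-1]) (p^`().[t^-1] * - t ^- 2).
    exact: (@is_derive1_comp _ (horner p) (fun s => s^-1) t _ _ (is_derive_poly p t^-1) dV).
  have H : is_derive t (1 : R) (fun s : R => p.[s^-1] * expR (- s^-1))
      (flat ('X^2 * (p - p^`())) t).
    apply: is_derive_eq (is_deriveM dp dE) _.
    rewrite /flat t0 !hornerE /GRing.scale/=.
    by field.
  apply: near_eq_is_derive H.
  near=> s; rewrite /flat ifT//; near: s; exact: lt_nbhsr.
- rewrite [flat _ 0]flat_le0//.
  have [C HC] := flat_bound ('X * p).
  have cv : (fun h : R => h^-1 *: ((flat p \o shift 0) (h *: 1) - flat p 0)) @ 0^' --> (0 : R).
    apply/cvgr0Pnorm_le => e e0.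
    have C0 : 0 < `|C| + 1 by rewrite ltr_wpDl.
    near=> h.
    have hN0 : h != 0 by near: h; exact: nbhs_dnbhs_neq.
    have he : `|h| < e / (`|C| + 1).
      by near: h; apply: dnbhs0_lt; rewrite divr_gt0.
    rewrite /= addr0 [flat p 0]flat_le0// subr0 [h *: 1]mulr1.
    have -> : h^-1 *: flat p h = flat ('X * p) h.
      rewrite /flat; case: ifP => _; last by rewrite scaler0.
      by rewrite hornerM hornerX -mulrA.
    apply: le_trans (HC h) _; apply: le_trans (_ : (`|C| + 1) * `|h| <= _).
      by rewrite ler_wpM2r// (le_trans (ler_norm _))// lerDl.
    by rewrite mulrC -ler_pdivlMr// ltW.
  by split; [apply/cvg_ex; exists 0 | exact: cvg_lim cv].
Unshelve. all: by end_near. Qed.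

(** The induction is on all [p] at once, because differentiation replaces [p] by another
    polynomial. *)
Lemma Ck_on_flat (V : normedModType R) k (U : set V) (p : {poly R}) (q : V -> R) :
  open U -> Ck_on k U q -> Ck_on k U (fun u => flat p (q u)).
Proof.
move=> oU; elim: k p => [|k IH] p Cq.
  split=> // u Uu; apply: (@continuous_comp _ _ _ q (flat p)); first exact: Cq.1.
  apply/differentiable_continuous/derivable1_diffP.
  by have [] := is_derive_flat p (q u).
split=> [u Uu|v].
  apply: (@continuous_comp _ _ _ q (flat p)); first exact: Cq.1.
  apply/differentiable_continuous/derivable1_diffP.
  by have [] := is_derive_flat p (q u).
have [dq Cdq] := Ck_onP v Cq.
have D u : U u -> is_derive u v (fun u => flat p (q u))
    (flat ('X^2 * (p - p^`())) (q u) * 'D_v q u).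
  move=> Uu; apply/is_derive1P.
  have /derivableP/is_derive1P dqu := dq u Uu.
  have := is_derive_flat p (q u).
  rewrite -{1}[u in X in is_derive X]add0r -(scale0r v) => H.
  exact: (@is_derive1_comp _ (flat p) (fun h : R => q (h *: v + u)) 0 _ _ H dqu).
split=> [u /D[]//|].
apply: Ck_on_eq (Ck_onM oU (IH ('X^2 * (p - p^`())) (Ck_onSk Cq)) Cdq) => // u Uu.
by have [_ ->] := D u Uu.
Qed.

End flat_function.

(** * Changes of charts *)

Section chart_change.
Variables (R : realType) (n : nat) (M : manifold R n).
Implicit Types (c d e : chart R n M) (x y : M).

(** Near a point of the image, the image is the preimage of [O] under the continuous map
    [chart_inv c]. *)
Lemma chart_image_open c (O : set M) : open O ->
  open (chart_map c @` (chart_dom c `&` O)).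
Proof.
move=> oO; rewrite openE => _ [y [cy Oy] <-].
have iy : (chart_map c @` chart_dom c) (chart_map c y) by exists y.
have nI : nbhs (chart_map c y) (chart_map c @` chart_dom c).
  by apply: open_nbhs_nbhs; split => //; exact: chart_img_open.
have nO : nbhs (chart_map c y) (chart_inv c @^-1` O).
  have := chart_inv_continuous iy; apply; rewrite chart_mapK//.
  exact: open_nbhs_nbhs.
apply: filterS (filterI nI nO) => u [[z cz <-]] /=; rewrite chart_mapK// => Oz.
by exists z.
Qed.

Definition overlap c d : set 'rV[R]_n :=
  chart_map c @` (chart_dom c `&` chart_dom d).

Definition transition c d : 'rV[R]_n -> 'rV[R]_n :=
  chart_map d \o chart_inv c.

Lemma overlap_open c d : open (overlap c d).
Proof. exact/chart_image_open/chart_dom_open. Qed.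

Lemma mem_overlap c d y :
  chart_dom c y -> chart_dom d y -> overlap c d (chart_map c y).
Proof. by move=> cy dy; exists y. Qed.

Lemma transitionE c d y : chart_dom c y ->
  transition c d (chart_map c y) = chart_map d y.
Proof. by move=> cy; rewrite /transition/= chart_mapK. Qed.

Lemma transition_overlap c d u : overlap c d u ->
  overlap d c (transition c d u).
Proof. by move=> [y [cy dy] <-]; rewrite transitionE//; exact: mem_overlap. Qed.

Lemma smooth_transition k c d : atlas c -> atlas d ->
  Ck_on k (overlap c d) (transition c d).
Proof. by move=> ca da; exact: (atlas_compatible ca da). Qed.

(* The components in [d] of the tangent vector at [y] with components [v]
   in [c]. *)
Definition chart_change c d y (v : 'rV[R]_n) : 'rV[R]_n :=
  'D_v (transition c d) (chart_map c y).

Lemma near_overlap c d y : chart_dom c y -> chart_dom d y ->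
  nbhs (chart_map c y) (overlap c d).
Proof.
move=> cy dy; apply: open_nbhs_nbhs; split; first exact: overlap_open.
exact: mem_overlap.
Qed.

(** The form in which the chain rule is applied later: velocities and tangent maps read in one chart
    are carried to another. *)
Lemma is_derive_chart_change c d y (V : normedModType R) (g : V -> 'rV[R]_n)
    (p v : V) (dg : 'rV[R]_n) : atlas c -> atlas d ->
  chart_dom c y -> chart_dom d y -> g p = chart_map c y ->
  is_derive p v g dg ->
  is_derive p v (transition c d \o g) (chart_change c d y dg).
Proof.
move=> ca da cy dy gp Hg; rewrite /chart_change -gp.
have Ug : overlap c d (g p) by rewrite gp; exact: mem_overlap.
exact: is_derive_comp (@overlap_open c d) (smooth_transition 1 ca da) Ug Hg.
Qed.

Lemma chart_change_id c y v : chart_dom c y -> chart_change c c y v = v.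
Proof.
move=> cy; rewrite /chart_change -[RHS](derive_id (chart_map c y) v).
apply: near_eq_derive; have := near_overlap cy cy.
by apply: filterS => _ [z [cz _] <-]; rewrite transitionE.
Qed.

Lemma chart_change_comp c d e y v : atlas c -> atlas d -> atlas e ->
  chart_dom c y -> chart_dom d y -> chart_dom e y ->
  chart_change d e y (chart_change c d y v) = chart_change c e y v.
Proof.
move=> ca da ea cy dy ey.
have Hd : is_derive (chart_map c y) v (transition c d) (chart_change c d y v).
  by apply: derivableP; apply: (Ck_onP v (smooth_transition 1 ca da)).1; exact: mem_overlap.
have [_ <-] := is_derive_chart_change da ea dy ey (transitionE d cy) Hd.
apply: near_eq_derive; have := near_overlap cy dy.
apply: filterS => _ [z [cz dz] <-].
by rewrite /= (transitionE d cz) !transitionE.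
Qed.

Lemma chart_change_sum c d y m (a : 'I_m -> R) (v : 'I_m -> 'rV[R]_n) :
  atlas c -> atlas d -> chart_dom c y -> chart_dom d y ->
  chart_change c d y (\sum_(i < m) a i *: v i) =
  \sum_(i < m) a i *: chart_change c d y (v i).
Proof.
move=> ca da cy dy.
apply: Ck1_derive_sum_rV (@overlap_open c d) (smooth_transition 1 ca da) _.
exact: mem_overlap.
Qed.

Lemma chart_changeZ c d y a v :
  atlas c -> atlas d -> chart_dom c y -> chart_dom d y ->
  chart_change c d y (a *: v) = a *: chart_change c d y v.
Proof.
move=> ca da cy dy.
have := chart_change_sum (fun _ : 'I_1 => a) (fun=> v) ca da cy dy.
by rewrite !big_ord1.
Qed.

Lemma chart_changeD c d y v w :
  atlas c -> atlas d -> chart_dom c y -> chart_dom d y ->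
  chart_change c d y (v + w) = chart_change c d y v + chart_change c d y w.
Proof.
move=> ca da cy dy.
have := chart_change_sum (fun _ : 'I_2 => 1)
  (fun i => if i == ord0 then v else w) ca da cy dy.
have E (g : 'I_2 -> 'rV[R]_n) : \sum_(i < 2) g i = g ord0 + g (lift ord0 ord0).
  by rewrite 2!big_ord_recl big_ord0 addr0.
by rewrite 2!E/= 4!scale1r.
Qed.

Lemma vf_in_chartE c (X : vfield M) y : chart_dom c y ->
  vf_in_chart c X (chart_map c y) = chart_change (chart_at y) c y (X y).
Proof. by move=> cy; rewrite /vf_in_chart chart_mapK. Qed.

Lemma vf_in_chart_at (X : vfield M) y :
  vf_in_chart (chart_at y) X (chart_map (chart_at y) y) = X y.
Proof.
by rewrite vf_in_chartE ?chart_change_id//; exact: chart_at_dom.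
Qed.

Lemma vf_in_chart_change c d (X : vfield M) y : atlas c -> atlas d ->
  chart_dom c y -> chart_dom d y ->
  vf_in_chart d X (chart_map d y) =
  chart_change c d y (vf_in_chart c X (chart_map c y)).
Proof.
move=> ca da cy dy.
rewrite (vf_in_chartE X dy) (vf_in_chartE X cy) chart_change_comp//.
- exact: chart_at_atlas.
- exact: chart_at_dom.
Qed.

Lemma smooth_vf_chart k c (X : vfield M) : smooth_vf X -> atlas c ->
  Ck_on k (chart_img c) (vf_in_chart c X).
Proof. by move=> sX ca; have := sX c ca k; rewrite setIT. Qed.

Lemma chart_img_openT c : open (chart_img c).
Proof. exact: chart_img_open. Qed.

Lemma vf_in_chart_scale c (f : M -> R) (X : vfield M) u : atlas c ->
  chart_img c u -> vf_in_chart c (fun y => f y *: X y) u =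
  f (chart_inv c u) *: vf_in_chart c X u.
Proof.
move=> ca [y cy <-].
rewrite (vf_in_chartE _ cy) (vf_in_chartE X cy) chart_mapK//.
by rewrite chart_changeZ//; [exact: chart_at_atlas | exact: chart_at_dom].
Qed.

Lemma vf_in_chart_add c (X Y : vfield M) u : atlas c ->
  chart_img c u -> vf_in_chart c (fun y => X y + Y y) u =
  vf_in_chart c X u + vf_in_chart c Y u.
Proof.
move=> ca [y cy <-].
rewrite (vf_in_chartE _ cy) (vf_in_chartE X cy) (vf_in_chartE Y cy).
by rewrite chart_changeD//; [exact: chart_at_atlas | exact: chart_at_dom].
Qed.

Lemma vf_in_chart_sum c m (a : 'I_m -> R) (X : 'I_m -> vfield M) u : atlas c ->
  chart_img c u -> vf_in_chart c (fun y => \sum_(i < m) a i *: X i y) u =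
  \sum_(i < m) a i *: vf_in_chart c (X i) u.
Proof.
move=> ca [y cy <-].
rewrite (vf_in_chartE _ cy) (chart_change_sum a (X^~ y) (chart_at_atlas y) ca
  (chart_at_dom y) cy).
by apply: eq_bigr => i _; rewrite (vf_in_chartE (X i) cy).
Qed.

Lemma smooth_vfP (X : vfield M) :
  (forall c k, atlas c -> Ck_on k (chart_img c) (vf_in_chart c X)) -> smooth_vf X.
Proof. by move=> H c ca k; rewrite setIT; exact: H. Qed.

Lemma smooth_vf_scale (f : M -> R) (X : vfield M) :
  smooth_fun f -> smooth_vf X -> smooth_vf (fun y => f y *: X y).
Proof.
move=> sf sX; apply: smooth_vfP => c k ca.
have oc := @chart_img_openT c.
have H : Ck_on k (chart_img c) (fun u => f (chart_inv c u) *: vf_in_chart c X u).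
  apply/(Ck_on_coord _ _ oc) => j.
  under eq_fun do rewrite mxE.
  apply: Ck_onM => //; first exact: sf.
  exact: ((Ck_on_coord k _ oc).1 (smooth_vf_chart k sX ca)).
by apply: Ck_on_eq H => // u cu; rewrite vf_in_chart_scale.
Qed.

Lemma smooth_vf_add (X Y : vfield M) :
  smooth_vf X -> smooth_vf Y -> smooth_vf (fun y => X y + Y y).
Proof.
move=> sX sY; apply: smooth_vfP => c k ca.
have oc := @chart_img_openT c.
apply: Ck_on_eq (Ck_onD oc (smooth_vf_chart k sX ca) (smooth_vf_chart k sY ca)) => // u cu.
by rewrite vf_in_chart_add.
Qed.

Lemma smooth_fun_cst (a : R) : smooth_fun (fun _ : M => a).
Proof. by move=> c ca k; exact: Ck_on_cst. Qed.

Lemma smooth_funM (f g : M -> R) :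
  smooth_fun f -> smooth_fun g -> smooth_fun (fun y => f y * g y).
Proof.
move=> sf sg c ca k; apply: (Ck_onM (@chart_img_openT c) (sf c ca k) (sg c ca k)).
Qed.

Lemma smooth_vf0 : smooth_vf ((fun=> 0) : vfield M).
Proof.
apply: smooth_vfP => c k ca.
apply: Ck_on_eq (Ck_on_cst k _ 0); first exact: chart_img_openT.
by move=> _ [y cy <-]; rewrite vf_in_chartE// /chart_change derive0.
Qed.

Lemma smooth_vf_sum m (X : 'I_m -> vfield M) :
  (forall i, smooth_vf (X i)) -> smooth_vf (fun y => \sum_(i < m) X i y).
Proof.
elim: m X => [|m IH] X sX.
  by under eq_fun do rewrite big_ord0; exact: smooth_vf0.
by under eq_fun do rewrite big_ord_recr/=; apply: smooth_vf_add => //; exact: IH.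
Qed.

Lemma overlapC_sub c d u : chart_img d u -> chart_dom c (chart_inv d u) ->
  overlap d c u.
Proof. by move=> [y dy <-]; rewrite chart_mapK// => cy; exact: mem_overlap. Qed.

(** Extension by zero: at a point of the chart domain [f] is read through [c], and any other point
    has the open complement of [K], where [f] vanishes, as a neighbourhood. *)
Lemma smooth_fun_chart c (K : set M) (f : M -> R) : atlas c -> closed K ->
  K `<=` chart_dom c -> (forall y, ~ K y -> f y = 0) ->
  (forall k, Ck_on k (chart_img c) (f \o chart_inv c)) -> smooth_fun f.
Proof.
move=> ca cK Kc f0 sf d da k; apply: Ck_on_local => u du.
have [cu|cu] := pselect (chart_dom c (chart_inv d u)).
  exists (overlap d c); first exact: overlapC_sub.
  have H : Ck_on k (overlap d c) ((f \o chart_inv c) \o transition d c).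
    apply: (Ck_on_comp_real (@overlap_open d c) (@chart_img_openT c)) (sf k) _.
      by move=> _ [y [dy cy] <-]; rewrite transitionE//; exists y.
    exact: smooth_transition.
  apply: Ck_on_eq H; first exact: overlap_open.
  by move=> _ [y [dy cy] <-] /=; rewrite !chart_mapK.
exists (chart_map d @` (chart_dom d `&` ~` K)).
  case: du cu => y dy <-; rewrite chart_mapK// => cy.
  by exists y => //; split => // /Kc.
apply: Ck_on_eq (Ck_on_cst k _ 0).
  exact/chart_image_open/closed_openC.
by move=> _ [y [dy Ky] <-] /=; rewrite chart_mapK// f0.
Qed.

Lemma smooth_vf_chart_ext c (K : set M) (X : vfield M) : atlas c -> closed K ->
  K `<=` chart_dom c -> (forall y, ~ K y -> X y = 0) ->
  (forall k, Ck_on k (chart_img c) (vf_in_chart c X)) -> smooth_vf X.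
Proof.
move=> ca cK Kc X0 sX; apply: smooth_vfP => d k da; apply: Ck_on_local => u du.
have [cu|cu] := pselect (chart_dom c (chart_inv d u)).
  exists (overlap d c); first exact: overlapC_sub.
  (* The components of [X] in [d] as a function of the coordinates in [c]: the Jacobian of the
     transition applied to the components in [c], expanded on the basis so that its smoothness is
     visible. *)
  pose F w := \sum_(j < n) vf_in_chart c X w 0 j *: 'D_(delta_mx 0 j) (transition c d) w.
  have sF : Ck_on k (overlap c d) F.
    apply: Ck_on_sum => [|j]; first exact: overlap_open.
    apply/(Ck_on_coord _ _ (@overlap_open c d)) => i.
    under eq_fun do rewrite mxE.
    apply: Ck_onM; first exact: overlap_open.
      apply: (Ck_on_coord k _ (@overlap_open c d)).1.
      by apply: Ck_onS (sX k) => _ [y [cy dy] <-]; exists y.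
    apply: (Ck_on_coord k _ (@overlap_open c d)).1.
    exact: (Ck_onP (delta_mx 0 j) (smooth_transition k.+1 ca da)).2.
  have H : Ck_on k (overlap d c) (F \o transition d c).
    apply: (Ck_on_comp (@overlap_open d c) (@overlap_open c d)) sF _.
      by move=> w; exact: transition_overlap.
    exact: smooth_transition.
  apply: Ck_on_eq H; first exact: overlap_open.
  move=> _ [y [dy cy] <-]; rewrite /= transitionE// (vf_in_chart_change X ca da cy dy).
  by rewrite [vf_in_chart c X _ in RHS]row_sum_delta chart_change_sum.
exists (chart_map d @` (chart_dom d `&` ~` K)).
  case: du cu => y dy <-; rewrite chart_mapK// => cy.
  by exists y => //; split => // /Kc.
apply: Ck_on_eq (Ck_on_cst k _ 0).
  exact/chart_image_open/closed_openC.
by move=> _ [y [dy Ky] <-] /=; rewrite vf_in_chartE// X0// /chart_change derive0.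
Qed.

End chart_change.

(** * Bump functions and tensoriality *)

(** Take [flat 1] of r^2 minus the Euclidean squared distance to [a], which is smooth unlike the max
    norm, and normalise at [a]. It vanishes off the closed cube of half-side r = e/2, which lies in
    the max-norm ball of radius e. *)
Lemma exists_bump (R : realType) n (O : set 'rV[R]_n) (a : 'rV[R]_n) :
  open O -> O a -> exists (phi : 'rV[R]_n -> R) (B : set 'rV[R]_n),
    [/\ compact B, B `<=` O, phi a = 1, forall u, ~ B u -> phi u = 0 &
        forall k, Ck_on k setT phi].
Proof.
move=> oO Oa; have : nbhs a O by exact: open_nbhs_nbhs.
move=> /nbhs_ballP[e /= e0 eO].
pose r := e / 2; have r0 : 0 < r by rewrite divr_gt0.
pose q (u : 'rV[R]_n) := r * r - \sum_(i < n) (u 0 i - a 0 i) * (u 0 i - a 0 i).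
have qa : q a = r * r.
  by rewrite /q big1 ?subr0// => i _; rewrite subrr mul0r.
have f0 : flat 1 (q a) != 0.
  by rewrite qa /flat mulr_gt0// hornerC mul1r expR_eq0.
pose B := [set u : 'rV[R]_n | forall i, `[a 0 i - r, a 0 i + r]%classic (u ord0 i)].
exists (fun u => flat 1 (q u) * (flat 1 (q a))^-1), B; split.
- apply: (@rV_compact R n (fun i => `[a 0 i - r, a 0 i + r]%classic)) => i.
  exact: segment_compact.
- move=> u Bu; apply: eO; split=> // i j; rewrite ord1.
  have := Bu j; rewrite /= in_itv/= => /andP[u1 u2].
  rewrite -ball_normE /ball_/= ltr_norml; rewrite /r in u1 u2 r0; lra.
- by rewrite mulfV.
- move=> u Bu; rewrite flat_le0 ?mul0r// leNgt; apply/negP => qu; apply: Bu => i.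
  have : (u 0 i - a 0 i) * (u 0 i - a 0 i) < r * r.
    rewrite -subr_gt0; apply: lt_le_trans qu _; rewrite lerD2l lerN2.
    rewrite (bigD1 i)//= lerDl sumr_ge0// => j _; exact: sqr_ge0.
  rewrite -!expr2 -subr_gt0 subr_sqr => H.
  rewrite /= in_itv/=; apply/andP; split; rewrite leNgt; apply/negP => ?; nra.
- move=> k; apply: Ck_onM; [exact: openT| |exact: Ck_on_cst].
  apply: Ck_on_flat; first exact: openT.
  apply: Ck_onD; [exact: openT|exact: Ck_on_cst|].
  have -> : (fun u : 'rV[R]_n => - \sum_(i < n) (u 0 i - a 0 i) * (u 0 i - a 0 i)) =
      (fun u => -1 * \sum_(i < n) (u 0 i - a 0 i) * (u 0 i - a 0 i)).
    by apply/funext => u; rewrite mulN1r.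
  apply: Ck_onM; [exact: openT|exact: Ck_on_cst|].
  apply: Ck_on_sum => [|i]; first exact: openT.
  have H : Ck_on k setT (fun u : 'rV[R]_n => u 0 i - a 0 i).
    apply: Ck_onD; [exact: openT| |exact: Ck_on_cst].
    exact: ((Ck_on_coord k (id : 'rV[R]_n -> 'rV[R]_n) openT).1 (Ck_on_id k _) i).
  by apply: Ck_onM => //; exact: openT.
Qed.

Lemma derive_lincombB (R : realType) (V W : normedModType R) m (a : 'I_m -> R)
    (F : 'I_m -> V -> W) (G : V -> W) (u v : V) :
  (forall i, derivable (F i) u v) -> derivable G u v ->
  'D_v (fun z => \sum_(i < m) a i *: F i z - G z) u =
  \sum_(i < m) a i *: 'D_v (F i) u - 'D_v G u.
Proof.
move=> dF dG.
have daF i : derivable (a i *: F i) u v by exact/derivableZ/dF.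
have -> : (fun z => \sum_(i < m) a i *: F i z - G z) =
    (\sum_(i < m) a i *: F i) - G.
  by apply/funext => z; rewrite -[RHS]/((\sum_(i < m) a i *: F i) z - _) fct_sumE.
rewrite (deriveB (derivable_sum daF) dG) (derive_sum daF).
by congr (_ - _); apply: eq_bigr => i _; exact: deriveZ.
Qed.

Section tensoriality.
Variables (R : realType) (n : nat) (M : manifold R n).
Variable nabla : vfield M -> vfield M -> vfield M.
Hypothesis Hnabla : linear_connection nabla.

Lemma connection_scale_vanish (Z X : vfield M) (f : M -> R) (x : M) :
  smooth_fun f -> smooth_vf Z -> smooth_vf X -> f x = 0 ->
  nabla Z (fun y => f y *: X y) x = vf_apply Z f x *: X x.
Proof. by move=> sf sZ sX f0; rewrite (connection_leibniz Hnabla)// f0 scale0r add0r. Qed.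

Lemma connection_sum (Z : vfield M) m (X : 'I_m -> vfield M) (x : M) :
  smooth_vf Z -> (forall i, smooth_vf (X i)) ->
  nabla Z (fun y => \sum_(i < m) X i y) x = \sum_(i < m) nabla Z (X i) x.
Proof.
move=> sZ; elim: m X => [|m IH] X sX.
  rewrite big_ord0.
  (* The zero field is written [0 *: Z], so that the Leibniz rule gives the value on the empty
     sum. *)
  have -> : (fun y : M => \sum_(i < 0) X i y) = (fun y => (0 : R) *: Z y).
    by apply/funext => y; rewrite big_ord0 scale0r.
  rewrite (connection_scale_vanish (@smooth_fun_cst _ _ M 0) sZ sZ)//.
  have -> : vf_apply Z (fun=> 0) x = 0 :> R by exact: derive_cst.
  by rewrite scale0r.
have -> : (fun y : M => \sum_(i < m.+1) X i y) =
    (fun y => \sum_(i < m) X (widen_ord (leqnSn m) i) y + X ord_max y).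
  by apply/funext => y; rewrite big_ord_recr.
rewrite big_ord_recr/= -(IH (fun i => X (widen_ord (leqnSn m) i)) (fun i => sX _)).
exact: (connection_addr Hnabla sZ (smooth_vf_sum (fun i => sX _)) (sX ord_max) x).
Qed.

Lemma connectionZ (Z X : vfield M) (a : R) (x : M) :
  smooth_vf Z -> smooth_vf X ->
  nabla Z (fun y => a *: X y) x = a *: nabla Z X x.
Proof.
move=> sZ sX; rewrite (connection_leibniz Hnabla)//; last exact: smooth_fun_cst.
have -> : vf_apply Z (fun=> a) x = 0 :> R by exact: derive_cst.
by rewrite scale0r addr0.
Qed.

(* With phi a bump function at x supported in the chart and W = sum w^k d_k
   there, phi^2 W = sum (phi w^k) (phi d_k) is a decomposition on global smooth
   fields, to which the Leibniz rule applies. *)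
Lemma connection_vanish (Z W : vfield M) (x : M) :
  smooth_vf Z -> smooth_vf W -> W x = 0 ->
  nabla Z W x =
  'D_(Z x) (vf_in_chart (chart_at x) W) (chart_map (chart_at x) x).
Proof.
move=> sZ sW W0; set c := chart_at x; set a := chart_map c x.
have ca : atlas c by exact: chart_at_atlas.
have cx : chart_dom c x by exact: chart_at_dom.
have ia : chart_img c a by exists x.
have oc := @chart_img_openT _ _ _ c.
have [phi [B [cB Bc phia phi0 sphi]]] := exists_bump oc ia.
have sphic k : Ck_on k (chart_img c) phi by apply: Ck_onS (sphi k).
pose K := chart_inv c @` B.
have Kc : K `<=` chart_dom c.
  by move=> _ [u /Bc[y cy <-] <-]; rewrite chart_mapK.
(* [K] is compact, hence closed since M is Hausdorff; extension by zero needs its complement to be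
   open. *)
have cK : closed K.
  apply: compact_closed; first exact: manifold_hausdorff.
  apply: continuous_compact cB; apply: continuous_in_subspaceT => u.
  by rewrite inE => /Bc; exact: chart_inv_continuous.
have phiK y : chart_dom c y -> ~ K y -> phi (chart_map c y) = 0.
  move=> cy Ky; apply: phi0 => By; apply: Ky; exists (chart_map c y) => //.
  by rewrite chart_mapK.
(* The default value 0 outside the chart continues these functions and fields smoothly, as [phi]
   vanishes off [B]. *)
pose f y := if `[< chart_dom c y >] then phi (chart_map c y) else 0.
pose Wc := vf_in_chart c W.
pose w k y := if `[< chart_dom c y >] then
  phi (chart_map c y) * Wc (chart_map c y) 0 k else 0.
pose E k : vfield M := fun y => if `[< chart_dom c y >] then
  chart_change c (chart_at y) y (phi (chart_map c y) *: delta_mx 0 k) else 0.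
have fE y : chart_dom c y -> f y = phi (chart_map c y).
  by move=> cy; rewrite /f asboolT.
have wE k y : chart_dom c y -> w k y = phi (chart_map c y) * Wc (chart_map c y) 0 k.
  by move=> cy; rewrite /w asboolT.
have EE k y : chart_dom c y ->
    E k y = chart_change c (chart_at y) y (phi (chart_map c y) *: delta_mx 0 k).
  by move=> cy; rewrite /E asboolT.
have sWc k l : Ck_on k (chart_img c) (fun u => Wc u 0 l).
  exact: (Ck_on_coord k _ oc).1 (smooth_vf_chart k sW ca) l.
have sf : smooth_fun f.
  apply: (smooth_fun_chart ca cK Kc) => [y Ky|k].
    by rewrite /f; case: asboolP => // cy; exact: phiK.
  apply: Ck_on_eq (sphic k) => // _ [y cy <-].
  by rewrite /= chart_mapK// fE.
have sw l : smooth_fun (w l).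
  apply: (smooth_fun_chart ca cK Kc) => [y Ky|k].
    by rewrite /w; case: asboolP => // cy; rewrite phiK// mul0r.
  apply: Ck_on_eq (Ck_onM oc (sphic k) (sWc k l)) => // _ [y cy <-].
  by rewrite /= chart_mapK// wE.
have sE l : smooth_vf (E l).
  apply: (smooth_vf_chart_ext ca cK Kc) => [y Ky|k].
    rewrite /E; case: asboolP => // cy.
    by rewrite phiK// scale0r /chart_change derive0.
  have H : Ck_on k (chart_img c) (fun u => phi u *: (delta_mx 0 l : 'rV[R]_n)).
    apply/(Ck_on_coord _ _ oc) => j; under eq_fun do rewrite mxE.
    by apply: Ck_onM => //; exact: Ck_on_cst.
  apply: Ck_on_eq H => // _ [y cy <-].
  rewrite vf_in_chartE// EE// chart_change_comp ?chart_change_id//.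
  - exact: chart_at_atlas.
  - exact: chart_at_dom.
have dec : (fun y => (f y * f y) *: W y) = (fun y => \sum_(k < n) w k y *: E k y).
  apply/funext => y; have [cy|cy] := pselect (chart_dom c y); last first.
    rewrite /f asboolF// mul0r scale0r big1// => k _.
    by rewrite /w asboolF// scale0r.
  have cc := chart_at_atlas y; have dy := chart_at_dom y.
  under eq_bigr do rewrite wE// EE// chart_changeZ// scalerA mulrAC -scalerA.
  rewrite fE// -[W y](chart_change_id _ dy).
  rewrite -(chart_change_comp _ cc ca cc dy cy dy) -vf_in_chartE// -/Wc.
  by rewrite [Wc _ in LHS]row_sum_delta chart_change_sum// -scaler_sumr.
have Wca : Wc a = 0 by rewrite /Wc /a /c vf_in_chart_at.
have fx : f x = 1 by rewrite fE.
(* As [f x = 1] and [W x = 0], the factor [f * f] does not change the covariant derivative at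
   [x]. *)
have N1 : nabla Z (fun y => (f y * f y) *: W y) x = nabla Z W x.
  rewrite (connection_leibniz Hnabla (smooth_funM sf sf) sZ sW x).
  by rewrite W0 scaler0 addr0 fx mulr1 scale1r.
have N2 := @connection_sum Z n (fun k y => w k y *: E k y) x sZ
  (fun k => smooth_vf_scale (sw k) (sE k)).
rewrite -N1 dec N2.
have [dWc _] := Ck_onP (Z x) (smooth_vf_chart 1 sW ca).
rewrite -/Wc in dWc *.
rewrite [RHS]row_sum_delta; apply: eq_bigr => k _.
(* The coefficients vanish at [x], so the Leibniz rule leaves only their derivatives; no covariant
   derivative of [E k] survives. *)
have w0 : w k x = 0 by rewrite wE// -/a Wca mxE mulr0.
rewrite (connection_scale_vanish (sw k) sZ (sE k) w0).
have -> : E k x = delta_mx 0 k.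
  by rewrite EE// -/c phia scale1r chart_change_id.
congr (_ *: _).
rewrite derive_mx; last exact: dWc.
rewrite mxE /vf_apply -/c -/a.
have [dW0 _] := Ck_onP (Z x) (sWc 1%N k).
have [dphi _] := Ck_onP (Z x) (sphic 1%N).
have -> : 'D_(Z x) (w k \o chart_inv c : _ -> R) a =
    'D_(Z x) (phi * (fun u => Wc u 0 k)) a.
  apply: near_eq_derive; have : nbhs a (chart_img c) by exact: open_nbhs_nbhs.
  by apply: filterS => _ [y cy <-] /=; rewrite chart_mapK// wE.
rewrite deriveM; [|exact: dphi|exact: dW0].
by rewrite Wca mxE scale0r addr0 phia scale1r.
Qed.

(** The field sum a_i E_i - Y, with constant coefficients, vanishes at [x]. By [connection_vanish],
    [nabla Z] and the componentwise derivative agree on it there. *)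
Lemma connection_tensorial (Z Y : vfield M) m (a : 'I_m -> R)
    (E : 'I_m -> vfield M) (x : M) (c := chart_at x) (u := chart_map c x) :
  smooth_vf Z -> smooth_vf Y -> (forall i, smooth_vf (E i)) ->
  \sum_(i < m) a i *: E i x = Y x ->
  \sum_(i < m) a i *: (nabla Z (E i) x - 'D_(Z x) (vf_in_chart c (E i)) u) =
  nabla Z Y x - 'D_(Z x) (vf_in_chart c Y) u.
Proof.
move=> sZ sY sE EY.
have ca : atlas c by exact: chart_at_atlas.
have cx : chart_dom c x by exact: chart_at_dom.
have iu : chart_img c u by exists x.
have saE i : smooth_vf (fun y => a i *: E i y).
  exact: (@smooth_vf_scale _ _ _ (fun=> a i) (E i) (@smooth_fun_cst _ _ M (a i)) (sE i)).
pose W1 y := \sum_(i < m) a i *: E i y.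
pose W2 : vfield M := fun y => (-1) *: Y y.
have sW1 : smooth_vf W1 by exact: smooth_vf_sum.
have sW2 : smooth_vf W2.
  exact: (@smooth_vf_scale _ _ _ (fun=> -1) Y (@smooth_fun_cst _ _ M (-1)) sY).
have W0 : W1 x + W2 x = 0 by rewrite /W1 /W2 EY scaleN1r subrr.
have d X : smooth_vf X -> derivable (vf_in_chart c X) u (Z x).
  by move=> sX; exact: (Ck_onP _ (smooth_vf_chart 1 sX ca)).1.
have N3 : 'D_(Z x) (vf_in_chart c (fun y => W1 y + W2 y)) u =
    \sum_(i < m) a i *: 'D_(Z x) (vf_in_chart c (E i)) u -
    'D_(Z x) (vf_in_chart c Y) u.
  rewrite -(derive_lincombB a (fun i => d _ (sE i)) (d _ sY)).
  apply: near_eq_derive.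
  have : nbhs u (chart_img c).
    by apply: open_nbhs_nbhs; split => //; exact: chart_img_open.
  apply: filterS => z cz; rewrite vf_in_chart_add// vf_in_chart_sum//.
  by rewrite vf_in_chart_scale// scaleN1r.
have := etrans (connection_vanish sZ (smooth_vf_add sW1 sW2) W0) N3.
have N1 := @connection_sum Z m (fun i y => a i *: E i y) x sZ saE.
have N2 i := connectionZ (a i) x sZ (sE i).
rewrite (connection_addr Hnabla sZ sW1 sW2 x) N1 (connectionZ (-1) x sZ sY).
rewrite (eq_bigr _ (fun i _ => N2 i)).
rewrite scaleN1r => H.
under eq_bigr do rewrite scalerBr.
rewrite big_split/= sumrN.
move/eqP: H; rewrite subr_eq => /eqP ->.
by rewrite addrC -!addrA addKr addrC.
Qed.

End tensoriality.

(** * Inverting parallel transport *)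

Lemma is_derive_scale_fun (R : realType) n (f : R -> R) (g : R -> 'rV[R]_n)
    (t df : R) (dg : 'rV[R]_n) :
  is_derive t 1 f df -> is_derive t 1 g dg ->
  is_derive t 1 (fun s => f s *: g s) (f t *: dg + df *: g t).
Proof.
move=> Hf /is_derive_rV Hg; apply/is_derive_rV => j.
under eq_fun do rewrite mxE.
apply: is_derive_eq (is_deriveM Hf (Hg j)) _.
by rewrite !mxE /GRing.scale/= [df * _]mulrC.
Qed.

Lemma is_derive_lincomb (R : realType) n m (f : 'I_m -> R -> R)
    (g : 'I_m -> R -> 'rV[R]_n) (t : R) (df : 'I_m -> R) (dg : 'I_m -> 'rV[R]_n) :
  (forall i, is_derive t 1 (f i) (df i)) -> (forall i, is_derive t 1 (g i) (dg i)) ->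
  is_derive t 1 (fun s => \sum_(i < m) f i s *: g i s)
    (\sum_(i < m) (f i t *: dg i + df i *: g i t)).
Proof.
move=> Hf Hg.
have -> : (fun s => \sum_(i < m) f i s *: g i s) =
    \sum_(i < m) (fun s => f i s *: g i s) by apply/funext => s; rewrite fct_sumE.
by apply: is_derive_sum => i; exact: is_derive_scale_fun.
Qed.

Lemma is_derive_unique (R : realType) (V W : normedModType R) (f : V -> W)
    (x v : V) (d1 d2 : W) : is_derive x v f d1 -> is_derive x v f d2 -> d1 = d2.
Proof. by move=> [_ <-] [_ <-]. Qed.

Lemma row_coord_le_norm (R : realType) n (v : 'rV[R]_n) k : `|v 0 k| <= `|v|.
Proof.
rewrite [leRHS]/Num.Def.normr/= mx_normrE.
exact: (le_bigmax _ (fun ij : 'I_1 * 'I_n => `|v ij.1 ij.2|) (0, k)).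
Qed.

(** If L v = 0, then v is the sum of the v_k (e_k - L e_k), whose norm is at most n/(n+1) |v|; this
    forces v = 0. *)
Lemma injective_near_id (R : realType) n (L : 'rV[R]_n -> 'rV[R]_n) (v : 'rV[R]_n) :
  (forall (a : 'I_n -> R) (w : 'I_n -> 'rV[R]_n),
    L (\sum_(k < n) a k *: w k) = \sum_(k < n) a k *: L (w k)) ->
  (forall k, `|delta_mx 0 k - L (delta_mx 0 k)| <= (n.+1%:R)^-1) ->
  L v = 0 -> v = 0.
Proof.
move=> linL Lid Lv0; apply/eqP; rewrite -normr_le0 leNgt; apply/negP => v0.
have N0 : 0 < n.+1%:R :> R by rewrite ltr0n.
suff : `|v| <= n%:R * (`|v| * (n.+1%:R)^-1).
  by rewrite mulrA ler_pdivlMr// mulrC ler_pM2r// ler_nat ltnn.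
have LvE : L v = \sum_(k < n) v 0 k *: L (delta_mx 0 k).
  by rewrite [v in LHS]row_sum_delta linL.
have vE : v = \sum_(k < n) v 0 k *: (delta_mx 0 k - L (delta_mx 0 k)).
  under eq_bigr do rewrite scalerBr.
  by rewrite sumrB -LvE Lv0 subr0 -row_sum_delta.
rewrite {1}vE; apply: le_trans (ler_norm_sum _ _ _) _.
apply: le_trans (_ : \sum_(k < n) `|v| * (n.+1%:R)^-1 <= _).
  by apply: ler_sum => k _; rewrite normrZ; apply: ler_pM => //; exact: row_coord_le_norm.
by rewrite sumr_const card_ord -[X in X <= _]mulr_natl lexx.
Qed.

Lemma derive_inverse_transport (R : realType) n (tau : R -> 'End('rV[R]_n))
    (C : R -> 'rV[R]_n -> 'rV[R]_n) (w : R -> 'rV[R]_n)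
    (q : 'rV[R]_n -> 'rV[R]_n) (b j : 'rV[R]_n) :
  (\forall t \near (0 : R), forall (a : 'I_n -> R) (v : 'I_n -> 'rV[R]_n),
    C t (\sum_(k < n) a k *: v k) = \sum_(k < n) a k *: C t (v k)) ->
  tau 0 = \1%VF -> (forall v, C 0 v = v) ->
  (forall v, is_derive (0 : R) (1 : R) (fun t => C t (tau t v)) (q v)) ->
  is_derive (0 : R) (1 : R) (fun t => (tau t)^-1%VF (w t)) b ->
  is_derive (0 : R) (1 : R) (fun t => C t (w t)) j ->
  b = j - q (w 0).
Proof.
move=> linC tau0 C0 HP HB HJ.
pose P (k : 'I_n) t := C t (tau t (delta_mx 0 k)).
have P0 (k : 'I_n) : P k 0 = delta_mx 0 k by rewrite /P tau0 C0 lfunE.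
have linP : \forall t \near (0 : R), forall v,
    C t (tau t v) = \sum_(k < n) v 0 k *: P k t.
  apply: filterS linC => t linCt v.
  rewrite [v in LHS]row_sum_delta linear_sum /P -linCt; congr (C t _).
  by apply: eq_bigr => k _; rewrite linearZ.
(* [^-1%VF] is a right inverse on the image only, so [tau t] has to be onto. For small [t] the map
   [C t \o tau t] is close to the identity, hence [tau t] is injective, and onto by dimension. *)
have invt : \forall t \near (0 : R), tau t ((tau t)^-1%VF (w t)) = w t.
  have N0 : 0 < (n.+1%:R)^-1 :> R by rewrite invr_gt0 ltr0n.
  have Pid : \forall t \near (0 : R), forall k : 'I_n, `|delta_mx 0 k - P k t| <= (n.+1%:R)^-1.
    apply: (@filter_forall _ 'I_n
      (fun k t => `|delta_mx 0 k - P k t| <= (n.+1%:R)^-1) _ (nbhs_filter _)) => k.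
    have cP : {for (0 : R), continuous (P k)}.
      apply/differentiable_continuous/derivable1_diffP.
      by have [] := HP (delta_mx 0 k).
    by move: cP => /cvgrPdist_le/(_ _ N0); rewrite P0.
  near=> t.
  have linCt : forall (a : 'I_n -> R) (v : 'I_n -> 'rV[R]_n),
    C t (\sum_(k < n) a k *: v k) = \sum_(k < n) a k *: C t (v k) by near: t.
  have Pt : forall k, `|delta_mx 0 k - P k t| <= (n.+1%:R)^-1 by near: t.
  have ker0 : lker (tau t) == 0%VS.
    rewrite -subv0; apply/subvP => v; rewrite memv_ker memv0 => /eqP tv0.
    apply/eqP; apply: (@injective_near_id _ _ (C t \o tau t) v _ Pt).
      move=> a v'; rewrite /= linear_sum -linCt; congr (C t _).
      by apply: eq_bigr => k _; rewrite linearZ.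
    have := linCt (fun=> 0) (fun=> 0).
    by rewrite /= tv0 !big1 // => *; rewrite scale0r.
  rewrite limg_lfunVK//.
  suff -> : limg (tau t) = fullv by rewrite memvf.
  apply/eqP; rewrite eqEdim subvf limg_dim_eq ?leqnn//.
  by rewrite (eqP ker0) capv0.
have B0 : (tau 0)^-1%VF (w 0) = w 0.
  by have := nbhs_singleton invt; rewrite {1}tau0 lfunE.
(* Linearity of [q], inherited from that of [C t \o tau t] by uniqueness of derivatives. *)
have HQ : q (w 0) = \sum_(k < n) w 0 0 k *: q (delta_mx 0 k).
  have H := @is_derive_lincomb R n n (fun k _ => w 0 0 k) P 0 (fun=> 0)
    (fun k => q (delta_mx 0 k)) (fun k => is_derive_cst _ _ _) (fun k => HP _).
  have HP0 : is_derive (0 : R) (1 : R) (fun s => \sum_(k < n) w 0 0 k *: P k s) (q (w 0)).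
    by apply: near_eq_is_derive (HP (w 0)); apply: filterS linP => t; exact.
  rewrite (is_derive_unique HP0 H); apply: eq_bigr => k _.
  by rewrite scale0r addr0.
have HBk k : is_derive (0 : R) (1 : R) (fun t => (tau t)^-1%VF (w t) 0 k) (b 0 k).
  by move/is_derive_rV: HB; exact.
(* The product rule for P(t) B(t) = J(t), written on the columns of P; P(0) is the identity, so
   J'(0) = B'(0) + P'(0) B(0). *)
have H := @is_derive_lincomb R n n (fun k t => (tau t)^-1%VF (w t) 0 k) P 0 (fun k => b 0 k)
    (fun k => q (delta_mx 0 k)) HBk (fun k => HP _).
have HJ' : is_derive (0 : R) (1 : R)
    (fun t => \sum_(k < n) (tau t)^-1%VF (w t) 0 k *: P k t) j.
  apply: near_eq_is_derive HJ; near=> t.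
  have <- : C t (tau t ((tau t)^-1%VF (w t))) =
    \sum_(k < n) (tau t)^-1%VF (w t) 0 k *: P k t.
    by near: t; apply: filterS linP => t; exact.
  congr (C t _); apply/esym; near: t; exact: invt.
rewrite (is_derive_unique HJ' H) big_split/= B0 -HQ addrC addrK.
by rewrite [LHS]row_sum_delta; apply: eq_bigr => k _; rewrite P0.
Unshelve. all: by end_near. Qed.

(** * Flows and the shape map *)

(** With [is_derive_pairr], this turns smoothness of a flow on a product into statements on its time
    and space derivatives separately. *)
Lemma is_derive_pairl (R : realType) (V W : normedModType R) (G : R * V -> W)
    (t : R) (u : V) (df : W) :
  is_derive (t, u) (1 : R, 0 : V) G df <->
  is_derive t 1 (fun s : R => G (s, u)) df.
Proof.
have E : (fun h : R => G (h *: (1 : R, 0 : V) + (t, u))) =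
    (fun h : R => G (h *: (1 : R) + t, u)).
  by apply/funext => h; congr G; congr pair; rewrite /= scaler0 add0r.
split=> /is_derive1P H; apply/is_derive1P; move: H; by rewrite E.
Qed.

Lemma is_derive_pairr (R : realType) (V W : normedModType R) (G : R * V -> W)
    (t : R) (u v : V) (df : W) :
  is_derive (t, u) (0 : R, v) G df <-> is_derive u v (fun y => G (t, y)) df.
Proof.
have E : (fun h : R => G (h *: (0 : R, v) + (t, u))) =
    (fun h : R => G (t, h *: v + u)).
  by apply/funext => h; congr G; congr pair; rewrite /= scaler0 add0r.
split=> /is_derive1P H; apply/is_derive1P; move: H; by rewrite E.
Qed.

Section flow.
Variables (R : realType) (n : nat) (M : manifold R n).
Variables (Z : vfield M) (e : R) (U : set M) (zeta : R -> M -> M).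
Hypotheses (oU : open U) (Hz : local_flow Z e U zeta).
Implicit Types (c d : chart R n M) (y : M) (t : R).

Definition flow_in_charts c d (q : R * 'rV[R]_n) : 'rV[R]_n :=
  chart_map d (zeta q.1 (chart_inv c q.2)).

Definition flow_dom c d : set (R * 'rV[R]_n) :=
  [set q | [/\ `|q.1| < e, (chart_map c @` (chart_dom c `&` U)) q.2 &
     chart_dom d (zeta q.1 (chart_inv c q.2))]].

(** Each of the three conditions is open at the point; for the last one this is joint continuity of
    the flow composed with [chart_inv c]. *)
Lemma nbhs_flow_dom c d t y : `|t| < e -> U y -> chart_dom c y ->
  chart_dom d (zeta t y) -> nbhs (t, chart_map c y) (flow_dom c d).
Proof.
move=> te Uy cy dy.
have n1 : nbhs t [set s : R | `|s| < e].
  have ct : {for t, continuous (fun s : R => `|s|)} by exact: norm_continuous.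
  apply: (ct [set s | s < e]); exact: lt_nbhsl.
have n2 : nbhs (chart_map c y) (chart_map c @` (chart_dom c `&` U)).
  apply: open_nbhs_nbhs; split; first exact: chart_image_open.
  by exists y.
have c1 : {for (t, chart_map c y), continuous (fst : R * 'rV[R]_n -> R)}.
  exact: cvg_fst.
have c2 : {for (t, chart_map c y), continuous (snd : R * 'rV[R]_n -> 'rV[R]_n)}.
  exact: cvg_snd.
have n3 : \forall q \near (t, chart_map c y),
    chart_dom d (zeta q.1 (chart_inv c q.2)).
  have cz : {for (t, chart_map c y), continuous
      ((fun q : R * M => zeta q.1 q.2) \o
       (fun q : R * 'rV[R]_n => (q.1, chart_inv c q.2)))}.
    apply: continuous_comp; last by rewrite /= chart_mapK//; exact: (flow_continuous Hz).
    have c3 : {for (t, chart_map c y), continuous (chart_inv c \o snd)}.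
      by apply: continuous_comp c2 _; apply: chart_inv_continuous; exists y.
    exact: (cvg_pair c1 c3).
  move: cz => /(_ (chart_dom d)); apply.
  apply: open_nbhs_nbhs; split; first exact: chart_dom_open.
  by rewrite /= chart_mapK.
apply: (@filterS3 _ _ (nbhs_filter _) _ _ _ _ _ (c1 _ n1) (c2 _ n2) n3).
by move=> q q1 q2 q3; split.
Qed.

Lemma smooth_flow_in_charts k c d : atlas c -> atlas d ->
  Ck_on k (flow_dom c d) (flow_in_charts c d).
Proof. by move=> ca da; exact: (flow_smooth Hz ca da). Qed.

Lemma near_chart_dom c d t y : `|t| < e -> U y -> chart_dom c y ->
  chart_dom d (zeta t y) ->
  \forall s \near t, flow_dom c d (s, chart_map c y).
Proof.
move=> te Uy cy dy; have N := nbhs_flow_dom te Uy cy dy.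
have cp : {for t, continuous (fun s : R => (s, chart_map c y))}.
  have c1 : {for t, continuous (fun s : R => s)} by exact: cvg_id.
  have c2 : {for t, continuous (fun _ : R => chart_map c y)} by exact: cvg_cst.
  exact: (cvg_pair c1 c2).
exact: cp N.
Qed.

Lemma near_chart_domr c d t y : `|t| < e -> U y -> chart_dom c y ->
  chart_dom d (zeta t y) ->
  \forall u \near chart_map c y, flow_dom c d (t, u).
Proof.
move=> te Uy cy dy; have N := nbhs_flow_dom te Uy cy dy.
have cp : {for chart_map c y, continuous (fun u : 'rV[R]_n => (t, u))}.
  have c1 : {for chart_map c y, continuous (fun _ : 'rV[R]_n => t)} by exact: cst_continuous.
  have c2 : {for chart_map c y, continuous (fun u : 'rV[R]_n => u)}
    by move=> B.
  exact: (cvg_pair c1 c2).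
exact: cp N.
Qed.

Lemma flow_velocity c y : 0 < e -> atlas c -> U y -> chart_dom c y ->
  is_derive (0 : R) (1 : R) (fun s => chart_map c (zeta s y))
    (vf_in_chart c Z (chart_map c y)).
Proof.
move=> e0 ca Uy cy; set d := chart_at y.
have da : atlas d by exact: chart_at_atlas.
have dy : chart_dom d y by exact: chart_at_dom.
have te : `|0 : R| < e by rewrite normr0.
have z0 := flow_origin Hz Uy.
have := flow_integral Hz te Uy; rewrite z0 -/d => H.
have g0 : (fun s => chart_map d (zeta s y)) 0 = chart_map d y by rewrite z0.
have := is_derive_chart_change da ca dy cy g0 H; rewrite (vf_in_chartE Z cy).
apply: near_eq_is_derive.
have dz : chart_dom d (zeta 0 y) by rewrite z0.
have := near_chart_dom te Uy cy dz; apply: filterS => s [_ _] /=.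
by rewrite chart_mapK// => ds; rewrite transitionE.
Qed.

(** [tangent_map] has its values in the preferred chart at [zeta t x], a choice that need not vary
    continuously with [t]. Read in the fixed chart [c], it is a space derivative of one smooth map,
    which can be differentiated in [t]. *)
Lemma flow_tangent_map c x t (v : 'rV[R]_n) (d := chart_at (zeta t x)) :
  c = chart_at x -> `|t| < e -> U x -> chart_dom c (zeta t x) ->
  chart_change d c (zeta t x) (tangent_map (zeta t) x v) =
  'D_(0 : R, v) (flow_in_charts c c) (t, chart_map c x).
Proof.
move=> cE te Ux cz.
have ca : atlas c by rewrite cE; exact: chart_at_atlas.
have cx : chart_dom c x by rewrite cE; exact: chart_at_dom.
have da : atlas d by exact: chart_at_atlas.
have dz : chart_dom d (zeta t x) by exact: chart_at_dom.
have N := near_chart_domr te Ux cx dz.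
have Nc := near_chart_domr te Ux cx cz.
have /derivableP/is_derive_pairr D1 :=
  (Ck_onP (0 : R, v) (smooth_flow_in_charts 1 ca da)).1 _ (nbhs_singleton N).
have /derivableP/is_derive_pairr D2 :=
  (Ck_onP (0 : R, v) (smooth_flow_in_charts 1 ca ca)).1 _ (nbhs_singleton Nc).
have g0 : (fun u => flow_in_charts c d (t, u)) (chart_map c x) =
    chart_map d (zeta t x).
  by rewrite /flow_in_charts/= chart_mapK.
have TE : tangent_map (zeta t) x v = 'D_(0 : R, v) (flow_in_charts c d) (t, chart_map c x).
  have [_ <-] := D1; by rewrite /tangent_map -cE.
have H := @is_derive_chart_change _ _ _ d c (zeta t x) _
  (fun u => flow_in_charts c d (t, u)) _ _ _ da ca dz cz g0 D1.
have [_ <-] := D2; have [_ HE] := H; rewrite TE -HE.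
apply: near_eq_derive; apply: filterS N => u [_ _ du].
by rewrite /= /flow_in_charts/= transitionE.
Qed.

(** The time derivative and the derivative along [v] are exchanged by [deriveC]; at time 0 the
    former gives the components of [Z] at every nearby point. *)
Lemma derive_flow_tangent c x (v : 'rV[R]_n) : 0 < e -> smooth_vf Z ->
  c = chart_at x -> U x ->
  is_derive (0 : R) (1 : R)
    (fun t => 'D_(0 : R, v) (flow_in_charts c c) (t, chart_map c x))
    ('D_v (vf_in_chart c Z) (chart_map c x)).
Proof.
move=> e0 sZ cE Ux.
have ca : atlas c by rewrite cE; exact: chart_at_atlas.
have cx : chart_dom c x by rewrite cE; exact: chart_at_dom.
have te : `|0 : R| < e by rewrite normr0.
have cz : chart_dom c (zeta 0 x) by rewrite (flow_origin Hz Ux).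
have N := nbhs_flow_dom te Ux cx cz.
(* [deriveC] asks for an open set, and [flow_dom c c] is only known to be a neighbourhood of the
   points considered. *)
pose S := (flow_dom c c)^°.
have oS : open S by exact: open_interior.
have CS : Ck_on 2 S (flow_in_charts c c).
  by apply: Ck_onS (smooth_flow_in_charts 2 ca ca); exact: interior_subset.
have [dv Cv] := Ck_onP (0 : R, v) CS.
have D1 := derivableP ((Ck_onP (1 : R, 0 : 'rV[R]_n) Cv).1 _ N).
have [d1 C1] := Ck_onP (1 : R, 0 : 'rV[R]_n) CS.
have D2 := derivableP ((Ck_onP (0 : R, v) C1).1 _ N).
have EC := deriveC (1 : R, 0 : 'rV[R]_n) (0 : R, v) oS CS N.
have EZ : 'D_(0 : R, v) ('D_(1 : R, 0 : 'rV[R]_n) (flow_in_charts c c))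
    (0, chart_map c x) = 'D_v (vf_in_chart c Z) (chart_map c x).
  have /is_derive_pairr [_ <-] := D2.
  apply: near_eq_derive.
  have oI : open (chart_map c @` (chart_dom c `&` U)) by exact: chart_image_open.
  have Ix : (chart_map c @` (chart_dom c `&` U)) (chart_map c x).
    exact: (ex_intro2 _ _ x (conj cx Ux) erefl).
  have nI := open_nbhs_nbhs (conj oI Ix).
  apply: filterS nI => _ [y [cy Uy] <-].
  have V := flow_velocity e0 ca Uy cy.
  have cz' : chart_dom c (zeta 0 y) by rewrite (flow_origin Hz Uy).
  have /derivableP/is_derive_pairl V' :=
    (Ck_onP (1 : R, 0 : 'rV[R]_n) (smooth_flow_in_charts 1 ca ca)).1 _
    (nbhs_singleton (nbhs_flow_dom te Uy cy cz')).
  have E : (fun s => flow_in_charts c c (s, chart_map c y)) =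
      (fun s => chart_map c (zeta s y)).
    by apply/funext => s; rewrite /flow_in_charts/= chart_mapK.
  rewrite E in V'; exact: is_derive_unique V' V.
have D1' := (is_derive_pairl _ _ _ _).1 D1.
exact: is_derive_eq D1' (etrans EC EZ).
Qed.

End flow.

(** * Parallel fields along a curve and the formula for the shape map *)

Section shape_map.
Variables (R : realType) (n : nat) (M : manifold R n).
Variable nabla : vfield M -> vfield M -> vfield M.
Hypothesis Hnabla : linear_connection nabla.

(** Differentiate V = sum f_i E_i in the chart. Parallelism replaces the terms f_i' E_i by - f_i
    nabla_Z E_i, leaving the sum of the f_i (D_Z - nabla_Z) E_i, which [connection_tensorial]
    evaluates on any field [Y] extending [V 0]. *)
Lemma derive_parallel c x (Z Y : vfield M) (gam : R -> M) (V : R -> 'rV[R]_n) :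
  c = chart_at x -> smooth_vf Z -> gam 0 = x ->
  (\forall t \near (0 : R), chart_dom c (gam t)) ->
  is_derive (0 : R) (1 : R) (fun t => chart_map c (gam t)) (Z x) ->
  parallel_at nabla Z gam V 0 -> smooth_vf Y -> Y x = V 0 ->
  is_derive (0 : R) (1 : R)
    (fun t => chart_change (chart_at (gam t)) c (gam t) (V t))
    ('D_(Z x) (vf_in_chart c Y) (chart_map c x) - nabla Z Y x).
Proof.
move=> cE sZ g0 cgam dgam [m [E [f [sE df VE]]]]; rewrite g0 => sum0 sY YV.
have ca : atlas c by rewrite cE; exact: chart_at_atlas.
have cx : chart_dom c x by rewrite cE; exact: chart_at_dom.
have EY : \sum_(i < m) f i 0 *: E i x = Y x.
  by rewrite YV; have := nbhs_singleton VE; rewrite g0.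
have T := connection_tensorial Hnabla sZ sY sE EY; rewrite -cE in T.
have dE i : is_derive (0 : R) (1 : R) (fun t => vf_in_chart c (E i) (chart_map c (gam t)))
    ('D_(Z x) (vf_in_chart c (E i)) (chart_map c x)).
  have Ug : chart_img c ((fun t => chart_map c (gam t)) 0).
    by rewrite g0; exists x.
  have := is_derive_comp (@chart_img_openT _ _ _ c) (smooth_vf_chart 1 (sE i) ca) Ug dgam.
  by rewrite g0.
have H := is_derive_lincomb (fun i => derivableP (df i)) dE.
have HE : is_derive (0 : R) (1 : R)
    (fun t => chart_change (chart_at (gam t)) c (gam t) (V t))
    (\sum_(i < m) (f i 0 *: 'D_(Z x) (vf_in_chart c (E i)) (chart_map c x) +
       'D_1 (f i) 0 *: vf_in_chart c (E i) (chart_map c (gam 0)))).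
  apply: near_eq_is_derive H.
  apply: filterS2 VE cgam => t -> ct.
  rewrite (chart_change_sum (f ^~ t) (fun i => E i (gam t)) (chart_at_atlas _) ca
    (chart_at_dom _) ct).
  by apply: eq_bigr => i _; rewrite (vf_in_chartE (E i) ct).
apply: is_derive_eq HE _.
have vE i : vf_in_chart c (E i) (chart_map c (gam 0)) = E i x.
  by rewrite g0 cE vf_in_chart_at.
apply/eqP; rewrite -subr_eq0 opprB -T -big_split/=; apply/eqP.
rewrite -[RHS]sum0; apply: eq_bigr => i _.
by rewrite vE scalerBr addrC addrA subrK addrC.
Qed.

(** Freezing the coefficients of the decomposition at time [t] yields a global smooth field through
    [V t]. *)
Lemma parallel_extension (Z : vfield M) (gam : R -> M) (V : R -> 'rV[R]_n)
    (t : R) : parallel_at nabla Z gam V t ->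
  exists X : vfield M, smooth_vf X /\ X (gam t) = V t.
Proof.
move=> [m [E [f [sE _ VE _]]]].
exists (fun y => \sum_(i < m) f i t *: E i y); split; last first.
  by rewrite (nbhs_singleton VE).
apply: smooth_vf_sum => i.
exact: (@smooth_vf_scale _ _ _ (fun=> f i t) (E i) (@smooth_fun_cst _ _ M _) (sE i)).
Qed.

(* A_Z(Y) = nabla_Z Y - [Z, Y]: the right-hand side is the covariant derivative
   along an integral curve of Z of the flow-invariant extension of Y. *)
Lemma shape_mapE (Z Y : vfield M) (A : M -> 'End('rV[R]_n)) (x : M) :
  smooth_vf Z -> smooth_vf Y -> is_shape_map nabla Z A ->
  A x (Y x) = nabla Z Y x - lie_bracket Z Y x.
Proof.
move=> sZ sY HA.
have [e [U [zeta [tau [e0 [oU Ux] Hz [tau0 tauP] HB]]]]] := HA x.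
pose c := chart_at x; have ca : atlas c by exact: chart_at_atlas.
have cx : chart_dom c x by exact: chart_at_dom.
have te : `|0 : R| < e by rewrite normr0.
have g0 : zeta 0 x = x := flow_origin Hz Ux.
have cz : chart_dom c (zeta 0 x) by rewrite g0.
have N : \forall t \near (0 : R), `|t| < e /\ chart_dom c (zeta t x).
  have := near_chart_dom oU Hz te Ux cx cz; apply: filterS => t [? _].
  by rewrite /= chart_mapK.
have Nc : \forall t \near (0 : R), chart_dom c (zeta t x).
  by apply: filterS N => t [].
(* [C t] reads tangent vectors at [zeta t x] in the fixed chart [c], so that vectors at different
   times can be compared. *)
pose C t := chart_change (chart_at (zeta t x)) c (zeta t x).
pose w t := tangent_map (zeta t) x (Y x).
pose q v := 'D_(1 : R) (fun t => C t (tau t v)) 0.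
have C0 v : C 0 v = v by rewrite /C g0 chart_change_id.
have dgam : is_derive (0 : R) (1 : R) (fun t => chart_map c (zeta t x)) (Z x).
  by have := flow_velocity oU Hz e0 ca Ux cx; rewrite vf_in_chart_at.
have tau0v v : tau 0 v = v by rewrite tau0 lfunE.
have DP v (X : vfield M) : smooth_vf X -> X x = v ->
    is_derive (0 : R) (1 : R) (fun t => C t (tau t v))
      ('D_(Z x) (vf_in_chart c X) (chart_map c x) - nabla Z X x).
  move=> sX Xv; apply: (derive_parallel (erefl c) sZ g0 Nc dgam (tauP v 0 te) sX).
  by rewrite Xv tau0v.
(* Transport of every vector must be differentiable, not only that of [Y x]; the smooth extension of
   [v] comes from its own parallel field. *)
have Dq v : is_derive (0 : R) (1 : R) (fun t => C t (tau t v)) (q v).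
  have [X [sX Xv]] := parallel_extension (tauP v 0 te).
  rewrite g0 tau0v in Xv.
  by have [d _] := DP v X sX Xv; exact: derivableP.
have qY : q (Y x) = 'D_(Z x) (vf_in_chart c Y) (chart_map c x) - nabla Z Y x.
  by have [_ <-] := DP (Y x) Y sY erefl.
have w0 : w 0 = Y x.
  rewrite /w /tangent_map g0 -/c -[RHS](derive_id (chart_map c x)).
  apply: near_eq_derive.
  have oI : open (chart_map c @` (chart_dom c `&` U)) by exact: chart_image_open.
  have Ix : (chart_map c @` (chart_dom c `&` U)) (chart_map c x).
    exact: (ex_intro2 _ _ x (conj cx Ux) erefl).
  apply: filterS (open_nbhs_nbhs (conj oI Ix)) => _ [y [cy Uy] <-].
  by rewrite /= chart_mapK// (flow_origin Hz Uy).
have linC : \forall t \near (0 : R), forall (a : 'I_n -> R) (v : 'I_n -> 'rV[R]_n),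
    C t (\sum_(k < n) a k *: v k) = \sum_(k < n) a k *: C t (v k).
  apply: filterS Nc => t ct a v.
  exact: chart_change_sum a v (chart_at_atlas _) ca (chart_at_dom _) ct.
have Dw : is_derive (0 : R) (1 : R) (fun t => C t (w t))
    ('D_(Y x) (vf_in_chart c Z) (chart_map c x)).
  apply: near_eq_is_derive (derive_flow_tangent oU Hz (Y x) e0 sZ (erefl c) Ux).
  apply: filterS N => t [et ct].
  exact: esym (flow_tangent_map oU Hz (Y x) (erefl c) et Ux ct).
(* The result is D_Y Z - (D_Z Y - nabla_Z Y), that is nabla_Z Y - [Z, Y]. *)
have := @derive_inverse_transport R n tau C w q _ _ linC tau0 C0 Dq (HB (Y x)) Dw.
by rewrite w0 qY => ->; rewrite /lie_bracket -/c !opprB addrCA.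
Qed.

End shape_map.

(** * Projections along a complement and the four items *)

Lemma daddv_pi_compl0 (K : fieldType) (vT : vectType K) (U V : {vspace vT}) v :
  (U :&: V = 0)%VS -> v \in U -> daddv_pi V U v = 0.
Proof.
move=> UV vU; have := daddv_pi_add UV (subvP (addvSl U V) v vU).
by rewrite daddv_pi_id// -[RHS]addr0 => /addrI.
Qed.

Unset Implicit Arguments.

Theorem proposition3p3 (R : realType) (n : nat) (M : manifold R n)
  (nabla : vfield M -> vfield M -> vfield M)
  (Hnabla : linear_connection nabla) (Htorsion : nonzero_torsion nabla)
  (p : nat) (D D' : M -> {vspace 'rV[R]_n})
  (HD : smooth_distribution p D) (Dint : integrable_distribution D)
  (HD' : smooth_distribution (n - p) D') (HDD' : complementary D D') :
  [/\ forall (X Y : vfield M) (A : M -> 'End('rV[R]_n)),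
        section_of D X -> section_of D Y -> is_shape_map nabla X A ->
        forall x, second_form nabla D D' X Y x =
                  proj_bot D D' (fun y => A y (Y y)) x,
      bilinear_on D (second_form nabla D D'),
      forall X Y : vfield M, section_of D X -> section_of D Y ->
        forall x, second_form nabla D D' X Y x - second_form nabla D D' Y X x =
                  proj_bot D D' (torsion nabla X Y) x &
      forall (X Y : vfield M) (A : M -> 'End('rV[R]_n)),
        section_of D X -> section_of D Y -> is_shape_map nabla X A ->
        forall x, proj_top D D' (fun y => A y (Y y) - nabla X Y y) x =
                  A x (Y x) - nabla X Y x].
Proof.
have top_bot x v : v \in D x -> daddv_pi (D' x) (D x) v = 0.
  by apply: daddv_pi_compl0; have [] := HDD' x.
have shapeD X Y A x : section_of D X -> section_of D Y -> is_shape_map nabla X A ->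
    A x (Y x) - nabla X Y x \in D x.
  move=> sX sY HA; rewrite (shape_mapE Hnabla x sX.1 sY.1 HA) addrAC subrr sub0r.
  by rewrite memvN; exact: (Dint X Y sX sY).2.
split.
- move=> X Y A sX sY HA x; apply/eqP; rewrite eq_sym -subr_eq0.
  rewrite /second_form /proj_bot -linearB/=.
  by rewrite (top_bot x) ?eqxx//; exact: shapeD.
- move=> f g X1 X2 Y sf sg [sX1 DX1] [sX2 DX2] [sY DY] x; split.
    rewrite /second_form /proj_bot (connection_linearl Hnabla sf sg sX1 sX2 sY).
    by rewrite linearP linearZ.
  have sfX := smooth_vf_scale sf sX1; have sgX := smooth_vf_scale sg sX2.
  rewrite /second_form /proj_bot (connection_addr Hnabla sY sfX sgX).
  rewrite (connection_leibniz Hnabla sf sY sX1) (connection_leibniz Hnabla sg sY sX2).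
  (* The Leibniz terms X(f) X1 and X(g) X2 lie in D, so the projection onto D' removes them; this
     makes the form linear over functions in its second argument. *)
  rewrite !linearD !linearZ/= (top_bot x (X1 x))// (top_bot x (X2 x))//.
  by rewrite !scaler0 !addr0.
- move=> X Y sX sY x; rewrite /second_form /proj_bot /torsion 2!linearB/=.
  by rewrite (top_bot x (lie_bracket X Y x)) ?subr0//; exact: (Dint X Y sX sY).2.
- move=> X Y A sX sY HA x; rewrite /proj_top daddv_pi_id//; last exact: shapeD.
  by have [] := HDD' x.
Qed.
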